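(* Let $G$ be a group with $b_1(G)<\infty$. Set $R=\mathbb{Z}[G_{\mathrm{ab}}]$ and $R_0=\mathbb{Z}[G_{\mathrm{abf}}]$, and let $\tilde\nu\colon R\to R_0$ be the ring map induced by the projection $G_{\mathrm{ab}}\to G_{\mathrm{abf}}$. Then the map $\kappa\colon B(G)\to B_{\mathbb{Q}}(G)$ induced by the inclusion $G'\hookrightarrow G'_{\mathbb{Q}}$ yields: (1) An isomorphism $\hat\kappa\otimes\mathbb{Q}\colon\widehat{B(G)\otimes\mathbb{Q}}\to\widehat{B_{\mathbb{Q}}(G)\otimes\mathbb{Q}}$ of filtered modules covering the surjective filtered ring map $\widehat{\tilde\nu}\otimes\mathbb{Q}\colon\widehat{R}\otimes\mathbb{Q}\to\widehat{R_0}\otimes\mathbb{Q}$. (2) An isomorphism $\mathrm{gr}(\kappa)\otimes\mathbb{Q}\colon\mathrm{gr}(B(G)\otimes\mathbb{Q})\to\mathrm{gr}(B_{\mathbb{Q}}(G)\otimes\mathbb{Q})$ covering the surjective map of graded rings $\mathrm{gr}(\tilde\nu)\otimes\mathbb{Q}\colon\mathrm{gr}(R)\otimes\mathbb{Q}\to\mathrm{gr}(R_0)\otimes\mathbb{Q}$.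
   Context: For $S\subseteq G$, $\sqrt{S}=\{g\in G: g^m\in S\text{ for some }m>0\}$. $G'=[G,G]$, $G''=[G',G']$, $G'_{\mathbb{Q}}=\sqrt{G'}$, $G''_{\mathbb{Q}}=\sqrt{[G'_{\mathbb{Q}},G'_{\mathbb{Q}}]}$, $G_{\mathrm{ab}}=G/G'$, $G_{\mathrm{abf}}=G_{\mathrm{ab}}/\mathrm{Tors}(G_{\mathrm{ab}})$, $b_1(G)=\dim_{\mathbb{Q}}H_1(G;\mathbb{Q})$. $B(G)=G'/G''$ is a $\mathbb{Z}[G_{\mathrm{ab}}]$-module and $B_{\mathbb{Q}}(G)=G'_{\mathbb{Q}}/G''_{\mathbb{Q}}$ a $\mathbb{Z}[G_{\mathrm{abf}}]$-module, via conjugation; $\kappa(gG'')=gG''_{\mathbb{Q}}$. Let $I$ and $I_0$ be the augmentation ideals of $R$ and $R_0$. Completions ($\widehat{M}=\varprojlim M/I^nM$) and associated graded objects ($\mathrm{gr}(M)=\bigoplus_{n\ge0}I^nM/I^{n+1}M$) of $R$, $B(G)$, $B(G)\otimes\mathbb{Q}$ are taken with respect to the $I$-adic filtration, and those of $R_0$, $B_{\mathbb{Q}}(G)$, $B_{\mathbb{Q}}(G)\otimes\mathbb{Q}$ with respect to the $I_0$-adic filtration. A map $\psi\colon M\to N$ from an $A$-module to a $C$-module covers a ring map $\varphi\colon A\to C$ if it is additive and $\psi(am)=\varphi(a)\psi(m)$. *)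

(* Defs.v *)
From HB Require Import structures.
From mathcomp Require Import all_boot all_algebra.
From mathcomp Require Import boolp.
From mathcomp Require Import finmap.
From mathcomp.multinomials Require Import monalg.

Set Implicit Arguments.
Unset Strict Implicit.
Unset Printing Implicit Defensive.

Import GRing.Theory.

Local Open Scope ring_scope.
Local Open Scope quotient_scope.

Notation "{ 'quot' I }" := (Quotient.quot I) : type_scope.

Inductive zgen (V : zmodType) (S : V -> Prop) : V -> Prop :=
| zgen0 : zgen S 0
| zgen_gen x of S x : zgen S x
| zgenB x y of zgen S x & zgen S y : zgen S (x - y).

Definition zspan (V : zmodType) (S : V -> Prop) : {pred V} :=
  fun x => `[< zgen S x >].

Lemma zspan_zmod_closed (V : zmodType) (S : V -> Prop) :
  zmod_closed (zspan S).
Proof.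
split; first by apply/asboolP; constructor.
by move=> x y /asboolP Sx /asboolP Sy; apply/asboolP; constructor.
Qed.

HB.instance Definition _ (V : zmodType) (S : V -> Prop) :=
  GRing.isZmodClosed.Build V (zspan S) (zspan_zmod_closed S).

Lemma mem_zspan (V : zmodType) (S : V -> Prop) x : S x -> x \in zspan S.
Proof. by move=> Sx; apply/asboolP; constructor. Qed.

Lemma zspan_sub (V W : zmodType) (S : V -> Prop) (f : {additive V -> W})
    (T : zmodClosed W) :
  (forall x, S x -> f x \in T) -> forall x, x \in zspan S -> f x \in T.
Proof.
move=> fS x /asboolP; elim=> [|y /fS //|y z _ fy _ fz]; first by rewrite raddf0 rpred0.
by rewrite raddfB rpredB.
Qed.

(* {malg int[K]} is the free abelian group on K; fext f is the Z-linear extension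
   of f. *)
HB.lock Definition fext (K : choiceType) (M : zmodType) (f : K -> M)
    (c : {malg int[K]}) : M :=
  \sum_(k <- msupp c) f k *~ c@_k.

Section Fext.
Variable K : choiceType.

Lemma fextEw (M : zmodType) (f : K -> M) (c : {malg int[K]}) (d : {fset K}) :
  (msupp c `<=` d)%fset -> fext f c = \sum_(k <- d) f k *~ c@_k.
Proof.
move=> le; rewrite fext.unlock; apply: big_fset_incl => // k _ kc.
by rewrite mcoeff_outdom // mulr0z.
Qed.

Lemma fext_is_additive (M : zmodType) (f : K -> M) : zmod_morphism (fext f).
Proof.
move=> x y.
have h := msuppB_le x y.
rewrite (fextEw f h) (fextEw f (fsubsetUl (msupp x) (msupp y))).
rewrite (fextEw f (fsubsetUr (msupp x) (msupp y))) -sumrB.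
by apply: eq_bigr => k _; rewrite mcoeffB mulrzBr.
Qed.

HB.instance Definition _ (M : zmodType) (f : K -> M) :=
  GRing.isZmodMorphism.Build {malg int[K]} M (fext f) (fext_is_additive f).

Lemma fextU (M : zmodType) (f : K -> M) k : fext f << k >> = f k.
Proof.
rewrite (fextEw f (@msuppU_le _ _ k 1)) big_seq_fset1.
by rewrite mcoeffUU mulr1z.
Qed.

Lemma malg_ind (P : {malg int[K]} -> Prop) :
  P 0 -> (forall k, P << k >>) -> (forall x y, P x -> P y -> P (x - y)) ->
  forall x, P x.
Proof.
move=> P0 Pg Pb x.
have PN s : P s -> P (- s) by move=> Ps; rewrite -sub0r; apply: Pb.
have PD s u : P s -> P u -> P (s + u).
  by move=> Ps /PN Pu; rewrite -(opprK u); apply: Pb.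
have PM s n : P s -> P (s *+ n).
  by move=> Ps; elim: n => // n IH; rewrite mulrS; apply: PD.
rewrite (monalgE x); elim/big_ind: _ => // k _.
have -> : << x@_k *g k >> = << k >> *~ x@_k :> {malg int[K]}.
  rewrite -(raddfMz (mkmalgU k : {additive int -> {malg int[K]}})).
  by rewrite intz.
case: (x@_k) => j; first by rewrite -pmulrn; apply: PM.
by rewrite NegzE mulrNz -pmulrn; apply/PN/PM.
Qed.

Lemma eq_fext (M : zmodType) (f g : K -> M) : f =1 g -> fext f =1 fext g.
Proof. by move=> fg c; rewrite !fext.unlock; apply: eq_bigr => k _; rewrite fg. Qed.

Lemma fext_addf (M : zmodType) (f g : K -> M) c :
  fext (fun k => f k + g k) c = fext f c + fext g c.
Proof. by rewrite !fext.unlock -big_split; apply: eq_bigr => k _; rewrite mulrzDl. Qed.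

Lemma fext_subf (M : zmodType) (f g : K -> M) c :
  fext (fun k => f k - g k) c = fext f c - fext g c.
Proof. by rewrite !fext.unlock -sumrB; apply: eq_bigr => k _; rewrite mulrzBl. Qed.

Lemma raddf_fext (M N : zmodType) (f : K -> M) (h : {additive M -> N}) c :
  h (fext f c) = fext (h \o f) c.
Proof. by rewrite !fext.unlock raddf_sum; apply: eq_bigr => k _; rewrite raddfMz. Qed.

End Fext.

Section QuotLemmas.
Variables (V : zmodType) (I : zmodClosed V).

Definition qpi (x : V) : {quot I} := \pi x.

Lemma qpi_is_additive : zmod_morphism qpi. Proof. exact: raddfB. Qed.

HB.instance Definition _ := GRing.isZmodMorphism.Build V {quot I} qpi qpi_is_additive.

Lemma qpiK (q : {quot I}) : qpi (repr q) = q. Proof. exact: reprK. Qed.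

Lemma qpi_eqP (x y : V) : x - y \in I <-> qpi x = qpi y.
Proof.
split=> [h|/eqP]; last by rewrite eqquotE /= Quotient.equivE.
by apply/eqP; rewrite eqquotE /= Quotient.equivE.
Qed.

End QuotLemmas.

Arguments qpi {V} I x.

Section QuotLemmas2.
Variables (V : zmodType) (I : zmodClosed V).

Lemma repr_piB (x : V) : repr (qpi I x) - x \in I.
Proof. by apply/qpi_eqP; rewrite qpiK. Qed.

Lemma qpi_eq0P (x : V) : x \in I <-> qpi I x = 0.
Proof.
rewrite -[X in X \in I]subr0; split=> [/qpi_eqP ->|h]; first exact: raddf0.
by apply/qpi_eqP; rewrite h raddf0.
Qed.

End QuotLemmas2.

Arguments repr_piB {V} I x.

Section Tensor.
Variables M N : zmodType.

(* The tensor product over Z: the free abelian group on M * N modulo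
   biadditivity. *)
Inductive bilin_rel : {malg int[(M * N)%type]} -> Prop :=
| bilin_l m m' n : bilin_rel (<< (m + m', n) >> - (<< (m, n) >> + << (m', n) >>))
| bilin_r m n n' : bilin_rel (<< (m, n + n') >> - (<< (m, n) >> + << (m, n') >>)).

Definition tensor : Type := {quot (zspan bilin_rel)}.
HB.instance Definition _ := GRing.Zmodule.on tensor.

Definition tens (m : M) (n : N) : tensor :=
  qpi (zspan bilin_rel) << (m, n) >>.

Lemma tens_addl m m' n : tens (m + m') n = tens m n + tens m' n.
Proof.
rewrite /tens -[RHS]raddfD.
apply/qpi_eqP; exact/mem_zspan/bilin_l.
Qed.

Lemma tens_addr m n n' : tens m (n + n') = tens m n + tens m n'.
Proof.
rewrite /tens -[RHS]raddfD.
apply/qpi_eqP; exact/mem_zspan/bilin_r.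
Qed.

Lemma tens_ind (P : tensor -> Prop) :
  (forall m n, P (tens m n)) -> (forall s t, P s -> P t -> P (s - t)) ->
  forall t, P t.
Proof.
move=> Pg Pb t.
rewrite -[t](@qpiK _ (zspan bilin_rel)).
elim/malg_ind: (repr _) => [|[m n]|x y hx hy]; rewrite ?(raddf0, raddfB).
- by rewrite -(subrr (tens 0 0)); apply: Pb.
- exact: Pg.
exact: Pb.
Qed.

Lemma tens_ext (P : zmodType) (f g : {additive tensor -> P}) :
  (forall m n, f (tens m n) = g (tens m n)) -> f =1 g.
Proof.
by move=> fg; apply: tens_ind => // s t fs ft; rewrite !raddfB fs ft.
Qed.

(* The additive map induced by f; meaningful when f is biadditive. *)
Definition tlift (P : zmodType) (f : M -> N -> P) (t : tensor) : P :=
  fext (fun k => f k.1 k.2) (repr t).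

Definition biadditive (P : zmodType) (f : M -> N -> P) :=
  (forall m m' n, f (m + m') n = f m n + f m' n) /\
  (forall m n n', f m (n + n') = f m n + f m n').

Section Lift.
Variables (P : zmodType) (f : M -> N -> P) (fB : biadditive f).

Lemma tlift_pi c : tlift f (qpi (zspan bilin_rel) c) = fext (fun k => f k.1 k.2) c.
Proof.
apply/eqP; rewrite -subr_eq0 -raddfB.
have/asboolP := repr_piB (zspan bilin_rel) c.
move: (repr _ - c) => d; elim=> [|x [m m' n|m n n']|x y _ /eqP hx _ /eqP hy].
- by rewrite raddf0.
- by rewrite raddfB raddfD /= !fextU /= fB.1 subrr.
- by rewrite raddfB raddfD /= !fextU /= fB.2 subrr.
by rewrite raddfB hx hy subrr.
Qed.

Lemma tliftE m n : tlift f (tens m n) = f m n.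
Proof. by rewrite tlift_pi fextU. Qed.

Lemma tlift_is_additive : zmod_morphism (tlift f).
Proof.
move=> s t; rewrite -[s](@qpiK _ (zspan bilin_rel)) -[t](@qpiK _ (zspan bilin_rel)) -raddfB !tlift_pi.
exact: raddfB.
Qed.

End Lift.

Lemma eq_tlift (P : zmodType) (f g : M -> N -> P) : 
  f =2 g -> tlift f =1 tlift g.
Proof. by move=> fg t; apply: eq_fext => -[m n] /=. Qed.

Lemma tlift_addf (P : zmodType) (f g : M -> N -> P) t :
  tlift (fun m n => f m n + g m n) t = tlift f t + tlift g t.
Proof. exact: fext_addf. Qed.

Lemma raddf_tlift (P Q : zmodType) (f : M -> N -> P) (h : {additive P -> Q}) t :
  h (tlift f t) = tlift (fun m n => h (f m n)) t.
Proof. exact: raddf_fext. Qed.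

End Tensor.

Lemma raddf_biadd (M N P Q : zmodType) (f : M -> N -> P) (h : {additive P -> Q}) :
  biadditive f -> biadditive (fun m n => h (f m n)).
Proof. by case=> f1 f2; split=> *; rewrite (f1, f2) raddfD. Qed.

Section TMap.
Variables (M M' N N' : zmodType) (f : {additive M -> M'}) (g : {additive N -> N'}).

Definition tmap : tensor M N -> tensor M' N' := tlift (fun m n => tens (f m) (g n)).

Lemma tmap_biadd : biadditive (fun m n => tens (f m) (g n)).
Proof. by split=> *; rewrite raddfD (tens_addl, tens_addr). Qed.

HB.instance Definition _ := GRing.isZmodMorphism.Build (tensor M N) (tensor M' N')
  tmap (tlift_is_additive tmap_biadd).

Lemma tmapE m n : tmap (tens m n) = tens (f m) (g n).
Proof. exact: (tliftE tmap_biadd). Qed.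

End TMap.

Section Groups.
Variable G : groupType.

Inductive ggen (S : G -> Prop) : G -> Prop :=
| ggen1 : ggen S 1%g
| ggen_gen x of S x : ggen S x
| ggenF x y of ggen S x & ggen S y : ggen S (x * y^-1)%g.

Definition gspan (S : G -> Prop) : {pred G} := fun g => `[< ggen S g >].

Definition gcomm (H K : {pred G}) : {pred G} :=
  gspan (fun g => exists x y, [/\ x \in H, y \in K & g = [~ x, y]%g]).

Definition isolator (S : {pred G}) : {pred G} :=
  fun g => `[< exists m, (0 < m)%N /\ (g ^+ m)%g \in S >].

Lemma gspan_closed S : group_closed (gspan S).
Proof.
split; first by apply/asboolP; constructor.
by move=> x y /asboolP Sx /asboolP Sy; apply/asboolP; constructor.
Qed.

Lemma mem_gcomm (H K : {pred G}) x y :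
  x \in H -> y \in K -> [~ x, y]%g \in gcomm H K.
Proof. by move=> Hx Ky; apply/asboolP/ggen_gen; exists x, y. Qed.

Lemma gcomm_sub (H K L : {pred G}) : group_closed L ->
  (forall x y, x \in H -> y \in K -> [~ x, y]%g \in L) ->
  {subset gcomm H K <= L}.
Proof.
move=> [L1 LF] hL g /asboolP; elim=> [//|x [a [b [Ha Kb ->]]]|x y _ Lx _ Ly].
  exact: hL.
exact: LF.
Qed.

Lemma mem_isolator (S : {pred G}) x : x \in S -> x \in isolator S.
Proof. by move=> Sx; apply/asboolP; exists 1%N; rewrite expg1. Qed.

Definition gnormal (H : {pred G}) := forall g x, x \in H -> (x ^ g)%g \in H.

Lemma gcomm_normal (H K : {pred G}) : gnormal H -> gnormal K -> gnormal (gcomm H K).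
Proof.
move=> nH nK g x /asboolP; elim=> {x} [|x [a [b [Ha Kb ->]]]|x y _ hx _ hy].
- rewrite conj1g; exact: (gspan_closed _).1.
- by rewrite conjRg; apply: mem_gcomm; [apply: nH|apply: nK].
rewrite conjMg conjVg; exact: (gspan_closed _).2.
Qed.

Lemma isolator_normal (H : {pred G}) : gnormal H -> gnormal (isolator H).
Proof.
move=> nH g x /asboolP[m [m0 hx]]; apply/asboolP; exists m; split=> //.
by rewrite -conjXg; apply: nH.
Qed.

(* An abelian section: subgroups bot <= top with abelian quotient top / bot. *)
Record absec := AbSec {
  sec_top : {pred G};
  sec_bot : {pred G};
  sec_topP : group_closed sec_top;
  sec_botP : group_closed sec_bot;
  sec_sub : {subset sec_bot <= sec_top};
  sec_comm : {in sec_top &, forall x y, [~ x, y]%g \in sec_bot}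
}.

Section Sec.
Variable P : absec.
Local Notation top := (sec_top P).
Local Notation bot := (sec_bot P).

Lemma top1 : 1%g \in top. Proof. exact: (sec_topP P).1. Qed.
Lemma topV x : x \in top -> (x^-1)%g \in top.
Proof. exact: group_closedV (sec_topP P) x. Qed.
Lemma topM x y : x \in top -> y \in top -> (x * y)%g \in top.
Proof. exact: group_closedM (sec_topP P) x y. Qed.
Lemma bot1 : 1%g \in bot. Proof. exact: (sec_botP P).1. Qed.
Lemma botV x : x \in bot -> (x^-1)%g \in bot.
Proof. exact: group_closedV (sec_botP P) x. Qed.
Lemma botM x y : x \in bot -> y \in bot -> (x * y)%g \in bot.
Proof. exact: group_closedM (sec_botP P) x y. Qed.

Lemma bot_conj x y : x \in bot -> y \in top -> (x ^ y)%g \in bot.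
Proof.
move=> xb yt; rewrite -[(x ^ y)%g](mulVKg x) -commgEl.
by apply: (botM xb); apply: sec_comm => //; apply: sec_sub.
Qed.

Definition sec_sort : Type := {x : G | x \in top}.
HB.instance Definition _ := SubChoice.on sec_sort.

Definition sec_eqv (u v : sec_sort) : bool := (val u * (val v)^-1)%g \in bot.

Lemma sec_eqv_equiv : equiv_class_of sec_eqv.
Proof.
split=> [x|x y|y x z]; rewrite /sec_eqv.
- by rewrite mulgV bot1.
- by apply/idP/idP=> /botV; rewrite invgF.
move=> h1 h2; have := botM h1 h2; by rewrite mulgA mulgVK.
Qed.

Canonical sec_eqv_equivrel := EquivRelPack sec_eqv_equiv.
Canonical sec_eqv_encmod := defaultEncModRel sec_eqv.

(* The quotient top / bot, written additively. *)
Definition quosec : Type := {eq_quot sec_eqv}.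
HB.instance Definition _ := Choice.on quosec.

(* Class of an element of top (junk outside top), and a representative. *)
Definition cls (g : G) : quosec :=
  \pi_({eq_quot sec_eqv}) (insubd (exist _ 1%g top1 : sec_sort) g).
Definition rep (q : quosec) : G := val (repr (q : {eq_quot sec_eqv})).

Lemma rep_top q : rep q \in top. Proof. exact: valP. Qed.

Lemma repK q : cls (rep q) = q.
Proof. by rewrite /cls /rep valKd reprK. Qed.

Lemma clsP g h : g \in top -> h \in top ->
  (g * h^-1)%g \in bot <-> cls g = cls h.
Proof.
move=> gt ht; rewrite /cls; split=> [gh|/eqP].
  by apply/eqP; rewrite eqquotE /= /sec_eqv !insubdK.
by rewrite eqquotE /= /sec_eqv !insubdK.
Qed.

Lemma clsPl g h : g \in top -> h \in top ->
  (g^-1 * h)%g \in bot <-> cls g = cls h.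
Proof.
move=> gt ht; rewrite -clsP //; split=> [/botV|].
  rewrite invgM invgK => b; rewrite -[(g * h^-1)%g]invgK.
  apply: botV; rewrite invgF.
  have := bot_conj (botV b) (topV gt).
  by rewrite conjgE !invgM !invgK -!mulgA mulVKg.
move=> b; have := bot_conj (botV b) gt.
by rewrite conjgE invgF -!mulgA mulVg mulg1.
Qed.

Lemma rep_cls g : g \in top -> (g^-1 * rep (cls g))%g \in bot.
Proof. by move=> gt; apply/clsPl => //; rewrite ?rep_top ?repK. Qed.

Lemma cls_mulr g b : g \in top -> b \in bot -> cls (g * b)%g = cls g.
Proof.
move=> gt bb; have bt := sec_sub bb; symmetry; apply/clsPl => //.
  exact: topM.
by rewrite mulKg.
Qed.

Definition qadd (p q : quosec) := cls (rep p * rep q)%g.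
Definition qopp (p : quosec) := cls (rep p)^-1%g.
Definition qzero := cls 1%g.

Lemma clsM g h : g \in top -> h \in top -> cls (g * h)%g = qadd (cls g) (cls h).
Proof.
move=> gt ht; apply/clsPl; rewrite ?topM ?rep_top //.
have b1 := rep_cls gt; have b2 := rep_cls ht.
have -> : ((g * h)^-1 * (rep (cls g) * rep (cls h)) =
   (g^-1 * rep (cls g)) ^ h * (h^-1 * rep (cls h)))%g.
  by rewrite conjgE invgM -!mulgA mulVKg.
by apply: botM => //; apply: bot_conj.
Qed.

Lemma clsV g : g \in top -> cls (g^-1)%g = qopp (cls g).
Proof.
move=> gt; apply/clsP; rewrite ?topV ?rep_top // invgK.
exact: rep_cls.
Qed.

Lemma qaddA : associative qadd.
Proof.
move=> x y z; rewrite -[x]repK -[y]repK -[z]repK.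
by rewrite -!clsM ?topM ?rep_top // mulgA.
Qed.

Lemma qaddC : commutative qadd.
Proof.
move=> x y; rewrite -[x]repK -[y]repK -!clsM ?rep_top //.
rewrite commgC cls_mulr ?topM ?rep_top //.
by apply: sec_comm; apply: rep_top.
Qed.

Lemma qadd0 : left_id qzero qadd.
Proof. by move=> x; rewrite -[x]repK -clsM ?top1 ?rep_top // mul1g. Qed.

Lemma qaddN : left_inverse qzero qopp qadd.
Proof.
move=> x; rewrite -[x]repK -clsV ?rep_top // -clsM ?topV ?rep_top //.
by rewrite mulVg.
Qed.

HB.instance Definition _ := GRing.isZmodule.Build quosec qaddA qaddC qadd0 qaddN.

Lemma clsD g h : g \in top -> h \in top -> cls (g * h)%g = cls g + cls h.
Proof. exact: clsM. Qed.

Lemma clsN g : g \in top -> cls (g^-1)%g = - cls g.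
Proof. exact: clsV. Qed.

Lemma cls0 : cls 1%g = 0. Proof. by []. Qed.

Lemma topX g n : g \in top -> (g ^+ n)%g \in top.
Proof. by move=> gt; elim: n => [|n IH]; rewrite ?top1 // expgS topM. Qed.

Lemma clsMn g n : g \in top -> cls (g ^+ n)%g = cls g *+ n.
Proof.
move=> gt; elim: n => [|n IH]; first by rewrite expg0 mulr0n cls0.
by rewrite expgS mulrS clsD ?topX // IH.
Qed.

Lemma cls_eq0 g : g \in top -> g \in bot <-> cls g = 0.
Proof.
move=> gt; rewrite -cls0 -(@clsP g 1%g) ?top1 //.
by rewrite invg1 mulg1.
Qed.

Lemma isolator_closed : {subset isolator bot <= top} -> group_closed (isolator bot).
Proof.
move=> sub; have torP g : g \in top -> g \in isolator bot <->
    exists m, (0 < m)%N /\ cls g *+ m = 0.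
  move=> gt; split=> [/asboolP[m [m0 /cls_eq0]]|[m [m0 h]]].
    by move=> /(_ (topX _ gt)); rewrite clsMn //; exists m.
  by apply/asboolP; exists m; split=> //; apply/cls_eq0; rewrite ?topX // clsMn.
split; first by apply: mem_isolator; apply: bot1.
move=> x y xi yi; have xt := sub _ xi; have yt := sub _ yi.
apply/torP; first by rewrite topM ?topV.
have [m [m0 hx]] := (torP _ xt).1 xi; have [n [n0 hy]] := (torP _ yt).1 yi.
exists (m * n)%N; split; first by rewrite muln_gt0 m0.
by rewrite clsD ?topV // clsN // mulrnBl mulrnA hx mul0rn mulnC mulrnA hy mul0rn subr0.
Qed.

Section Conj.
Hypotheses (nt : gnormal top) (nb : gnormal bot).

Definition conj_cls (g : G) (q : quosec) : quosec := cls (g * rep q * g^-1)%g.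

Lemma conj_clsE g h : h \in top -> conj_cls g (cls h) = cls (g * h * g^-1)%g.
Proof.
have E x : (g * x * g^-1 = x ^ g^-1)%g by rewrite conjgE invgK mulgA.
move=> ht; rewrite /conj_cls !E; apply/esym/clsPl; rewrite ?nt ?rep_top //.
by rewrite -conjVg -conjMg; apply: nb; apply: rep_cls.
Qed.

Lemma conj_top g h : h \in top -> (g * h * g^-1)%g \in top.
Proof.
have E x : (g * x * g^-1 = x ^ g^-1)%g by rewrite conjgE invgK mulgA.
by move=> ht; rewrite E; apply: nt.
Qed.

Lemma conj_cls_is_additive g : zmod_morphism (conj_cls g).
Proof.
move=> x y; rewrite -[x]repK -[y]repK -clsN ?rep_top // -clsD ?topV ?rep_top //.
rewrite !conj_clsE ?topM ?topV ?rep_top // -clsN ?conj_top ?rep_top //.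
rewrite -clsD ?topV ?conj_top ?rep_top //; congr cls.
by rewrite !invgM invgK !mulgA mulgVK.
Qed.

Lemma conj_clsM g h q : conj_cls (g * h)%g q = conj_cls g (conj_cls h q).
Proof.
rewrite -[q]repK !conj_clsE ?conj_top ?rep_top //; congr cls.
by rewrite invgM !mulgA.
Qed.

Lemma conj_cls1 q : conj_cls 1%g q = q.
Proof. by rewrite -[q]repK conj_clsE ?rep_top // mul1g invg1 mulg1. Qed.

Lemma conj_cls_id g q :
  (forall x, x \in top -> [~ x, g^-1]%g \in bot) -> conj_cls g q = q.
Proof.
move=> h; rewrite -[q]repK conj_clsE ?rep_top //.
apply/esym/clsPl; rewrite ?conj_top ?rep_top //.
by have := h _ (rep_top q); rewrite commgEl conjgE invgK (mulgA g).
Qed.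

End Conj.
End Sec.
End Groups.

Section Derived.
Variable G : groupType.

(* G', G'', G'_Q and G''_Q. *)
Definition der1 : {pred G} := gcomm predT predT.
Definition der2 : {pred G} := gcomm der1 der1.
Definition derQ1 : {pred G} := isolator der1.
Definition derQ2 : {pred G} := isolator (gcomm derQ1 derQ1).

Lemma predT_closed : group_closed (predT : {pred G}). Proof. by split. Qed.
Lemma der1_closed : group_closed der1. Proof. exact: gspan_closed. Qed.
Lemma der2_closed : group_closed der2. Proof. exact: gspan_closed. Qed.

Lemma der1_comm : {in predT &, forall x y : G, [~ x, y]%g \in der1}.
Proof. by move=> x y _ _; apply: mem_gcomm. Qed.

Lemma der1T : {subset der1 <= predT}. Proof. by []. Qed.

Definition gab_sec : absec G := AbSec predT_closed der1_closed der1T der1_comm.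

Lemma derQ1_closed : group_closed derQ1.
Proof. exact: (@isolator_closed G gab_sec). Qed.

Lemma der2_comm : {in der1 &, forall x y : G, [~ x, y]%g \in der2}.
Proof. by move=> x y hx hy; apply: mem_gcomm. Qed.

Lemma der2_sub : {subset der2 <= der1}.
Proof. by apply: gcomm_sub; [exact: der1_closed|move=> *; apply: mem_gcomm]. Qed.

Definition alex_sec : absec G := AbSec der1_closed der2_closed der2_sub der2_comm.

Lemma der_sub_Q : {subset der1 <= derQ1}.
Proof. by move=> x; apply: mem_isolator. Qed.

Lemma commQ_sub : {subset gcomm derQ1 derQ1 <= derQ1}.
Proof.
apply: gcomm_sub; first exact: derQ1_closed.
by move=> x y _ _; apply: der_sub_Q; apply: mem_gcomm.
Qed.

Lemma commQ_comm : {in derQ1 &, forall x y : G, [~ x, y]%g \in gcomm derQ1 derQ1}.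
Proof. by move=> x y hx hy; apply: mem_gcomm. Qed.

Definition alexQ0_sec : absec G :=
  AbSec derQ1_closed (gspan_closed _) commQ_sub commQ_comm.

Lemma derQ2_sub : {subset derQ2 <= derQ1}.
Proof.
move=> x /asboolP[m [m0 /commQ_sub/asboolP[k [k0 h]]]].
by apply/asboolP; exists (m * k)%N; rewrite muln_gt0 m0 expgnA.
Qed.

Lemma derQ2_closed : group_closed derQ2.
Proof. exact: (@isolator_closed G alexQ0_sec derQ2_sub). Qed.

Lemma derQ2_comm : {in derQ1 &, forall x y : G, [~ x, y]%g \in derQ2}.
Proof. by move=> x y hx hy; apply/mem_isolator/mem_gcomm. Qed.

Definition alexQ_sec : absec G :=
  AbSec derQ1_closed derQ2_closed derQ2_sub derQ2_comm.

Lemma der1_normal : gnormal der1. Proof. exact: gcomm_normal. Qed.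
Lemma der2_normal : gnormal der2. Proof. exact: gcomm_normal der1_normal der1_normal. Qed.
Lemma derQ1_normal : gnormal derQ1. Proof. exact: isolator_normal der1_normal. Qed.
Lemma derQ2_normal : gnormal derQ2.
Proof. by apply/isolator_normal/gcomm_normal; exact: derQ1_normal. Qed.

Definition Gab : Type := quosec gab_sec.
HB.instance Definition _ := GRing.Zmodule.on Gab.

End Derived.

Definition tors (A : zmodType) : {pred A} :=
  fun a => `[< exists n, (0 < n)%N /\ a *+ n = 0 >].

Lemma tors_zmod_closed (A : zmodType) : zmod_closed (@tors A).
Proof.
split; first by apply/asboolP; exists 1%N.
move=> x y /asboolP[m [m0 hx]] /asboolP[n [n0 hy]]; apply/asboolP.
exists (m * n)%N; split; first by rewrite muln_gt0 m0.
by rewrite mulrnBl mulrnA hx mul0rn mulnC mulrnA hy mul0rn subr0.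
Qed.

HB.instance Definition _ (A : zmodType) :=
  GRing.isZmodClosed.Build A (@tors A) (@tors_zmod_closed A).

Definition Gabf (G : groupType) : Type := {quot (@tors (Gab G))}.
HB.instance Definition _ (G : groupType) := GRing.Zmodule.on (Gabf G).

Definition nu (G : groupType) : Gab G -> Gabf G := qpi (@tors (Gab G)).
HB.instance Definition _ (G : groupType) :=
  GRing.isZmodMorphism.Build (Gab G) (Gabf G) (@nu G) (qpi_is_additive _).

(* B(G) = G' / G'' and B_Q(G) = G'_Q / G''_Q, written additively. *)
Definition Alex (G : groupType) : Type := quosec (alex_sec G).
HB.instance Definition _ (G : groupType) := GRing.Zmodule.on (Alex G).

Definition AlexQ (G : groupType) : Type := quosec (alexQ_sec G).
HB.instance Definition _ (G : groupType) := GRing.Zmodule.on (AlexQ G).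

(* g . (h G'') = g h g^-1 G'', see gab_actE; and g . (h G''_Q) = g h g^-1 G''_Q,
   see gabf_actE. *)
Section Actions.
Variable G : groupType.

Definition gab_act (x : Gab G) (b : Alex G) : Alex G := conj_cls (rep x) b.

Lemma conj_der1 (k : G) (b : Alex G) : k \in @der1 G -> conj_cls k b = b :> quosec (alex_sec G).
Proof.
move=> kd; apply: conj_cls_id; [exact: der1_normal|exact: der2_normal|].
move=> x xt; apply: mem_gcomm => //.
exact: (@topV _ (alex_sec G)).
Qed.

Lemma gab_actE (g : G) (b : Alex G) :
  gab_act (cls (gab_sec G) g) b = conj_cls g b :> quosec (alex_sec G).
Proof.
rewrite /gab_act; have kb := @rep_cls _ (gab_sec G) g isT.
rewrite -[rep _](mulVKg g) conj_clsM; try exact: der1_normal; try exact: der2_normal.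
by rewrite (conj_der1 _ kb).
Qed.

Lemma gab_act_additive x : zmod_morphism (gab_act x).
Proof. apply: (@conj_cls_is_additive _ (alex_sec G)); [exact: der1_normal|exact: der2_normal]. Qed.

Lemma gab_act0 b : gab_act 0 b = b.
Proof.
rewrite -(@cls0 _ (gab_sec G)) gab_actE.
apply: conj_cls1; [exact: der1_normal|exact: der2_normal].
Qed.

Lemma gab_actD x y b : gab_act (x + y) b = gab_act x (gab_act y b).
Proof.
rewrite -[x](@repK _ (gab_sec G)) -[y](@repK _ (gab_sec G)).
rewrite -clsD // !gab_actE.
apply: conj_clsM; [exact: der1_normal|exact: der2_normal].
Qed.

Definition gabf_act (x : Gabf G) (b : AlexQ G) : AlexQ G :=
  conj_cls (rep (repr x : Gab G)) b.

Lemma conj_derQ1 (k : G) (b : AlexQ G) :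
  k \in @derQ1 G -> conj_cls k b = b :> quosec (alexQ_sec G).
Proof.
move=> kd; apply: conj_cls_id; [exact: derQ1_normal|exact: derQ2_normal|].
move=> x xt; apply/mem_isolator/mem_gcomm => //.
exact: (@topV _ (alexQ_sec G)).
Qed.

Lemma tors_derQ1 (g : G) : cls (gab_sec G) g \in @tors (Gab G) -> g \in @derQ1 G.
Proof.
move=> /asboolP[m [m0]]; rewrite -clsMn // => /cls_eq0 h.
by apply/asboolP; exists m; split=> //; apply: h.
Qed.

Lemma gabf_actE (g : G) (b : AlexQ G) :
  gabf_act (nu (cls (gab_sec G) g)) b = conj_cls g b :> quosec (alexQ_sec G).
Proof.
rewrite /gabf_act; set h := rep _.
have kb : (g^-1 * h)%g \in @derQ1 G.
  apply: tors_derQ1; rewrite clsD // clsN // /h repK addrC.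
  exact: repr_piB.
rewrite -[h](mulVKg g) conj_clsM; try exact: derQ1_normal; try exact: derQ2_normal.
by rewrite (conj_derQ1 _ kb).
Qed.

Lemma gabf_repK (x : Gabf G) : exists g : G, x = nu (cls (gab_sec G) g).
Proof.
exists (rep (repr x : Gab G)); rewrite repK; apply: esym.
exact: (@qpiK _ (@tors (Gab G)) x).
Qed.

Lemma gabf_act_additive x : zmod_morphism (gabf_act x).
Proof. apply: (@conj_cls_is_additive _ (alexQ_sec G)); [exact: derQ1_normal|exact: derQ2_normal]. Qed.

Lemma gabf_act0 b : gabf_act 0 b = b.
Proof.
have -> : 0 = nu (cls (gab_sec G) 1%g) by rewrite cls0 raddf0.
rewrite gabf_actE; apply: conj_cls1; [exact: derQ1_normal|exact: derQ2_normal].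
Qed.

Lemma gabf_actD x y b : gabf_act (x + y) b = gabf_act x (gabf_act y b).
Proof.
have [g ->] := gabf_repK x; have [h ->] := gabf_repK y.
rewrite -raddfD -clsD // !gabf_actE.
apply: conj_clsM; [exact: derQ1_normal|exact: derQ2_normal].
Qed.

(* g G'' |-> g G''_Q, see kappaE. *)
Definition kappa (b : Alex G) : AlexQ G := cls (alexQ_sec G) (rep b).

Lemma der2_subQ : {subset @der2 G <= @derQ2 G}.
Proof.
move=> x xd; apply: mem_isolator; apply: (gcomm_sub _ _ xd); first exact: gspan_closed.
by move=> y z hy hz; apply: mem_gcomm; apply: der_sub_Q.
Qed.

Lemma kappaE (g : G) : g \in @der1 G -> kappa (cls (alex_sec G) g) = cls (alexQ_sec G) g.
Proof.
move=> gd; rewrite /kappa; apply/esym/clsPl; rewrite /=; first exact: der_sub_Q.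
  apply: der_sub_Q; exact: (@rep_top _ (alex_sec G)).
by apply: der2_subQ; apply: (@rep_cls _ (alex_sec G)).
Qed.

Lemma kappa_is_additive : zmod_morphism kappa.
Proof.
move=> x y; rewrite -[x](@repK _ (alex_sec G)) -[y](@repK _ (alex_sec G)).
have hx : rep x \in @der1 G := @rep_top _ (alex_sec G) x.
have hy : rep y \in @der1 G := @rep_top _ (alex_sec G) y.
have hyV := @topV _ (alex_sec G) _ hy; have hxy := @topM _ (alex_sec G) _ _ hx hyV.
rewrite -clsN // -clsD // !kappaE // clsD ?clsN //; try exact: der_sub_Q.
Qed.

HB.instance Definition _ := GRing.isZmodMorphism.Build (Alex G) (AlexQ G) kappa kappa_is_additive.

Lemma kappa_act x b : kappa (gab_act x b) = gabf_act (nu x) (kappa b).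
Proof.
rewrite -[x](@repK _ (gab_sec G)) -[b](@repK _ (alex_sec G)).
have hb : rep b \in @der1 G := @rep_top _ (alex_sec G) b.
rewrite gab_actE gabf_actE conj_clsE //; [|exact: der1_normal|exact: der2_normal].
rewrite !kappaE //; last by apply: (@conj_top _ (alex_sec G)) => //; exact: der1_normal.
rewrite conj_clsE //; [exact: derQ1_normal|exact: derQ2_normal|exact: der_sub_Q].
Qed.

End Actions.

(* The group ring Z[A] of an abelian group A; A is written additively, so the
   basis elements multiply by gbasis a * gbasis b = gbasis (a + b). *)

Section GroupRing.
Variable A : zmodType.

Definition gring : Type := {malg int[A]}.
HB.instance Definition _ := GRing.Zmodule.on gring.

Definition gbasis (a : A) : gring := << a >>.

Definition gr_one : gring := gbasis 0.
Definition gr_mul (x y : gring) : gring :=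
  fext (fun a => fext (fun b => gbasis (a + b)) y) x.

Lemma gr_mulUU (a b : A) : gr_mul (gbasis a) (gbasis b) = gbasis (a + b).
Proof. by rewrite /gr_mul !fextU. Qed.

Lemma gr_mulBl x y z : gr_mul (x - y) z = gr_mul x z - gr_mul y z.
Proof. exact: raddfB. Qed.

Lemma gr_mulBr x y z : gr_mul x (y - z) = gr_mul x y - gr_mul x z.
Proof.
rewrite /gr_mul -fext_subf; apply: eq_fext => a; exact: raddfB.
Qed.

HB.instance Definition _ x := GRing.isZmodMorphism.Build gring gring (gr_mul x) (gr_mulBr x).

Definition gr_mulr y x := gr_mul x y.
Lemma gr_mulr_add y : zmod_morphism (gr_mulr y). Proof. by move=> x z; apply: gr_mulBl. Qed.
HB.instance Definition _ y := GRing.isZmodMorphism.Build gring gring (gr_mulr y) (gr_mulr_add y).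

Lemma gring_ind (P : gring -> Prop) :
  (forall a, P (gbasis a)) -> (forall x y, P x -> P y -> P (x - y)) -> forall x, P x.
Proof.
move=> Pg Pb; apply: malg_ind => //.
rewrite -(subrr gr_one); exact: Pb (Pg 0) (Pg 0).
Qed.

Lemma gr_mulC : commutative gr_mul.
Proof.
elim/gring_ind=> [a|x y hx hy] z; last by rewrite gr_mulBl gr_mulBr hx hy.
elim/gring_ind: z => [b|x y hx hy]; last by rewrite gr_mulBl gr_mulBr hx hy.
by rewrite !gr_mulUU addrC.
Qed.

Lemma gr_mulA : associative gr_mul.
Proof.
elim/gring_ind=> [a|x x' hx hx'] y z; last by rewrite !gr_mulBl hx hx'.
elim/gring_ind: y => [b|y y' hy hy']; last by rewrite !(gr_mulBl, gr_mulBr) hy hy'.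
elim/gring_ind: z => [c|z z' hz hz']; last first.
  exact: etrans (congr1 (gr_mul _) (gr_mulBr _ _ _)) (etrans (gr_mulBr _ _ _)
    (etrans (congr2 (fun u v => u - v) hz hz') (esym (gr_mulBr _ _ _)))).
by rewrite !gr_mulUU addrA.
Qed.

Lemma gr_mul1 : left_id gr_one gr_mul.
Proof.
elim/gring_ind=> [a|x y hx hy]; last by rewrite gr_mulBr hx hy.
by rewrite gr_mulUU add0r.
Qed.

Lemma gr_mulDl : left_distributive gr_mul +%R.
Proof. by move=> x y z; apply: raddfD. Qed.

Lemma gr_one_neq0 : gr_one != 0.
Proof. by apply/eqP/malgP=> /(_ 0) /eqP; rewrite mcoeffUU mcoeff0 oner_eq0. Qed.

HB.instance Definition _ := GRing.Zmodule_isComNzRing.Build gring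
  gr_mulA gr_mulC gr_mul1 gr_mulDl gr_one_neq0.

Lemma gbasisD a b : gbasis (a + b) = gbasis a * gbasis b.
Proof. exact: esym (gr_mulUU a b). Qed.

Lemma gbasis0 : gbasis 0 = 1. Proof. by []. Qed.

Definition aug (x : gring) : int := fext (fun _ : A => 1%Z) x.
HB.instance Definition _ := GRing.isZmodMorphism.Build gring int aug (fext_is_additive _).

Definition aug_ideal : {pred gring} := fun x => aug x == 0.

(* The Z[A]-module structure of an abelian group on which A acts. *)
Section Act.
Variables (M : zmodType) (act : A -> M -> M).
Hypotheses (act_add : forall a, zmod_morphism (act a))
  (act0 : forall m, act 0 m = m)
  (actD : forall a b m, act (a + b) m = act a (act b m)).

Definition gscale (x : gring) (m : M) : M := fext (act^~ m) x.

Lemma gscaleU a m : gscale (gbasis a) m = act a m. Proof. exact: fextU. Qed.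
Lemma gscaleBl m : zmod_morphism (gscale^~ m). Proof. exact: fext_is_additive. Qed.
Lemma gscaleBr x : zmod_morphism (gscale x).
Proof.
move=> m n; rewrite /gscale -fext_subf; apply: eq_fext => a; exact: act_add.
Qed.

Lemma gscaleA x y m : gscale x (gscale y m) = gscale (x * y) m.
Proof.
elim/gring_ind: x => [a|x x' hx hx']; last first.
  by rewrite mulrBl [LHS]gscaleBl [RHS]gscaleBl hx hx'.
elim/gring_ind: y => [b|y y' hy hy']; last first.
  by rewrite mulrBr (gscaleBl _ y) gscaleBr hy hy' -(gscaleBl _ (_ * y)).
by rewrite -gbasisD !gscaleU actD.
Qed.

Lemma gscale1 : left_id 1 gscale.
Proof. by move=> m; rewrite -gbasis0 gscaleU act0. Qed.

Lemma gscaleDr : right_distributive gscale +%R.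
Proof.
move=> x m n; have /= h := @raddfD _ _ (HB.pack_for {additive M -> M} (gscale x)
  (GRing.isZmodMorphism.Build M M (gscale x) (gscaleBr x))).
exact: h.
Qed.

Lemma gscaleDl m : {morph gscale^~ m : x y / x + y}.
Proof. by move=> x y; apply: raddfD. Qed.

End Act.
End GroupRing.

HB.instance Definition _ (G : groupType) :=
  GRing.Zmodule_isLmodule.Build (gring (Gab G)) (Alex G)
    (gscaleA (@gab_act_additive G) (@gab_actD G))
    (gscale1 (@gab_act0 G)) (gscaleDr (@gab_act_additive G)) (gscaleDl (@gab_act G)).

HB.instance Definition _ (G : groupType) :=
  GRing.Zmodule_isLmodule.Build (gring (Gabf G)) (AlexQ G)
    (gscaleA (@gabf_act_additive G) (@gabf_actD G))
    (gscale1 (@gabf_act0 G)) (gscaleDr (@gabf_act_additive G)) (gscaleDl (@gabf_act G)).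

Arguments aug_ideal A : clear implicits.

Section GRingMap.
Variables (A B : zmodType) (f : {additive A -> B}).

Definition gring_map (x : gring A) : gring B := fext (fun a => gbasis (f a)) x.

HB.instance Definition _ := GRing.isZmodMorphism.Build (gring A) (gring B)
  gring_map (fext_is_additive _).

Lemma gring_mapU a : gring_map (gbasis a) = gbasis (f a). Proof. exact: fextU. Qed.

Lemma gring_map_monoid : monoid_morphism gring_map.
Proof.
split=> [|x y]; first by rewrite -gbasis0 gring_mapU raddf0.
elim/gring_ind: x => [a|x x' hx hx']; last by rewrite mulrBl !raddfB /= mulrBl hx hx'.
elim/gring_ind: y => [b|y y' hy hy']; last first.
  have -> : gring_map (gbasis a * (y - y')) =
      gring_map (gbasis a * y) - gring_map (gbasis a * y').
    by rewrite mulrBr; exact: raddfB.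
  have -> : gring_map (y - y') = gring_map y - gring_map y' by exact: raddfB.
  by rewrite mulrBr hy hy'.
by rewrite -gbasisD !gring_mapU raddfD gbasisD.
Qed.

HB.instance Definition _ := GRing.isMonoidMorphism.Build (gring A) (gring B)
  gring_map gring_map_monoid.

Lemma aug_gring_map x : aug (gring_map x) = aug x.
Proof.
elim/gring_ind: x => [a|x y hx hy]; last by rewrite !raddfB /= hx hy.
by rewrite gring_mapU /aug !fextU.
Qed.

Lemma aug_ideal_map x : x \in aug_ideal A -> gring_map x \in aug_ideal B.
Proof. by rewrite !unfold_in /aug_ideal aug_gring_map. Qed.

End GRingMap.

Definition nu_tilde (G : groupType) : gring (Gab G) -> gring (Gabf G) :=
  gring_map (@nu G).
HB.instance Definition _ (G : groupType) := GRing.RMorphism.on (@nu_tilde G).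

Lemma kappa_semilinear (G : groupType) (r : gring (Gab G)) (b : Alex G) :
  kappa (r *: b) = nu_tilde r *: kappa b.
Proof.
elim/gring_ind: r => [a|x y hx hy]; last by rewrite !raddfB /= !scalerBl raddfB /= hx hy.
have -> : gbasis a *: b = gab_act a b by exact: gscaleU.
rewrite kappa_act.
have -> : nu_tilde (gbasis a) = gbasis (nu a) by exact: gring_mapU.
by apply: esym; apply: gscaleU.
Qed.

(* First rational homology, by the inhomogeneous bar complex
   Q[G x G] --d2--> Q[G] --d1--> Q, where d2 [g|h] = [h] - [g h] + [g]
   and d1 [g] = [] - [] = 0. *)
Section H1.
Variable G : groupType.

Inductive bar_d2 : {malg rat[G]} -> Prop :=
| Bar_d2 (q : rat) (g h : G) : bar_d2 (q *: (<< h >> - << (g * h)%g >> + << g >>)).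

Definition H1Q : Type := {quot (zspan bar_d2)}.
HB.instance Definition _ := GRing.Zmodule.on H1Q.

Definition H1Q_scale (q : rat) (x : H1Q) : H1Q := qpi (zspan bar_d2) (q *: repr x).

Lemma bar_scale q x : x \in zspan bar_d2 -> q *: x \in zspan bar_d2.
Proof.
apply: (zspan_sub (f := *:%R q)) => y [p g h]; rewrite /= scalerA.
by apply: mem_zspan.
Qed.

Lemma H1Q_scaleE q x : H1Q_scale q (qpi (zspan bar_d2) x) = qpi (zspan bar_d2) (q *: x).
Proof. apply/qpi_eqP. by rewrite -scalerBr bar_scale // repr_piB. Qed.

Lemma H1Q_scaleA p q x : H1Q_scale p (H1Q_scale q x) = H1Q_scale (p * q) x.
Proof. by rewrite H1Q_scaleE scalerA. Qed.

Lemma H1Q_scale1 : left_id 1 H1Q_scale.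
Proof. by move=> x; rewrite /H1Q_scale scale1r; apply: qpiK. Qed.

Lemma H1Q_scaleDr : right_distributive H1Q_scale +%R.
Proof.
move=> q x y; rewrite -[x](@qpiK _ (zspan bar_d2)) -[y](@qpiK _ (zspan bar_d2)).
by rewrite -raddfD !H1Q_scaleE scalerDr raddfD.
Qed.

Lemma H1Q_scaleDl x : {morph H1Q_scale^~ x : p q / p + q}.
Proof. by move=> p q; rewrite /H1Q_scale scalerDl raddfD. Qed.

HB.instance Definition _ := GRing.Zmodule_isLmodule.Build rat H1Q
  H1Q_scaleA H1Q_scale1 H1Q_scaleDr H1Q_scaleDl.

End H1.

Definition findim (F : fieldType) (V : lmodType F) : Prop :=
  exists n (e : 'I_n -> V), forall v, exists c : 'I_n -> F, v = \sum_i c i *: e i.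

Definition b1_finite (G : groupType) : Prop := findim (H1Q G).

Section TensorRing.
Variables A B : comPzRingType.

(* (a (x) b) (a' (x) b') = a a' (x) b b' *)
Definition tmul1 (a : A) (b : B) (t : tensor A B) : tensor A B :=
  tlift (fun a' b' => tens (a * a') (b * b')) t.
Definition tmul (s t : tensor A B) : tensor A B := tlift (fun a b => tmul1 a b t) s.
Definition tone : tensor A B := tens 1 1.

Lemma tmul1_biadd a b : biadditive (fun (a' : A) (b' : B) => tens (a * a') (b * b')).
Proof. by split=> *; rewrite mulrDr (tens_addl, tens_addr). Qed.

Lemma tmul_biadd t : biadditive (fun a b => tmul1 a b t).
Proof.
by split=> *; rewrite /tmul1 -tlift_addf; apply: eq_tlift => a' b';
  rewrite mulrDl (tens_addl, tens_addr).
Qed.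

Lemma tmulE a b a' b' : tmul (tens a b) (tens a' b') = tens (a * a') (b * b').
Proof. by rewrite /tmul (tliftE (tmul_biadd _)) /tmul1 (tliftE (tmul1_biadd _ _)). Qed.

Lemma tmulBl t : zmod_morphism (tmul^~ t).
Proof. exact: tlift_is_additive (tmul_biadd t). Qed.

Lemma tmulBr s : zmod_morphism (tmul s).
Proof.
move=> t u; elim/tens_ind: s => [a b|s s' hs hs'].
  by rewrite /tmul !(tliftE (tmul_biadd _)); exact: (tlift_is_additive (tmul1_biadd a b) t u).
rewrite !(tmulBl _ s s') hs hs' !opprD !opprK !addrA.
by congr (_ + _); rewrite -!addrA; congr (_ + _); rewrite addrC.
Qed.

Lemma tmulC : commutative tmul.
Proof.
elim/tens_ind=> [a b|s s' hs hs'] t; last by rewrite (tmulBl _ s s') tmulBr hs hs'.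
elim/tens_ind: t => [a' b'|t t' ht ht']; last by rewrite (tmulBl _ t t') tmulBr ht ht'.
by rewrite !tmulE mulrC (mulrC b).
Qed.

Lemma tmulA : associative tmul.
Proof.
elim/tens_ind=> [a b|s s' hs hs'] t u; last by rewrite !(tmulBl _ s s') !(tmulBl u) hs hs'.
elim/tens_ind: t => [a' b'|t t' ht ht']; last first.
  by rewrite !(tmulBl u t t') !tmulBr (tmulBl u) ht ht'.
elim/tens_ind: u => [a'' b''|u u' hu hu']; last by rewrite !tmulBr hu hu'.
by rewrite !tmulE !mulrA.
Qed.

Lemma tmul_1 : left_id tone tmul.
Proof.
elim/tens_ind=> [a b|s t hs ht]; last by rewrite tmulBr hs ht.
by rewrite tmulE !mul1r.
Qed.

Lemma tmulDl : left_distributive tmul +%R.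
Proof.
move=> s t u; have /= h := @raddfD _ _ (HB.pack_for {additive tensor A B -> tensor A B} (tmul^~ u)
  (GRing.isZmodMorphism.Build _ _ (tmul^~ u) (tmulBl u))).
exact: h.
Qed.

HB.instance Definition _ := GRing.Zmodule_isComPzRing.Build (tensor A B)
  tmulA tmulC tmul_1 tmulDl.

Lemma tensM a b a' b' : tens a b * tens a' b' = tens (a * a') (b * b') :> tensor A B.
Proof. exact: tmulE. Qed.

Lemma tens1 : 1 = tens 1 1 :> tensor A B. Proof. by []. Qed.

End TensorRing.

Lemma tmap_monoid (A A' B B' : comPzRingType) (f : {rmorphism A -> A'})
  (g : {rmorphism B -> B'}) : monoid_morphism (tmap f g).
Proof.
split=> [|s t]; first by rewrite tens1 tmapE /= !rmorph1.
elim/tens_ind: s => [a b|s s' hs hs']; last by rewrite mulrBl !raddfB /= mulrBl hs hs'.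
elim/tens_ind: t => [a' b'|t t' ht ht']; last by rewrite mulrBr !raddfB /= mulrBr ht ht'.
by rewrite tensM !tmapE /= !rmorphM tensM.
Qed.

HB.instance Definition _ (A A' B B' : comPzRingType) (f : {rmorphism A -> A'})
  (g : {rmorphism B -> B'}) :=
  GRing.isMonoidMorphism.Build (tensor A B) (tensor A' B') (tmap f g) (tmap_monoid f g).

Section TensorMod.
Variables (R : pzRingType) (M : lmodType R) (N : zmodType).

Definition tscale (r : R) : tensor M N -> tensor M N := tmap ( *:%R r) idfun.

Lemma tscaleE r m n : tscale r (tens m n) = tens (r *: m) n.
Proof. exact: tmapE. Qed.

Lemma tscaleB r s t : tscale r (s - t) = tscale r s - tscale r t.
Proof. exact: raddfB. Qed.

Lemma tscaleD r s t : tscale r (s + t) = tscale r s + tscale r t.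
Proof. exact: raddfD. Qed.

Lemma tscaleA r s t : tscale r (tscale s t) = tscale (r * s) t.
Proof.
elim/tens_ind: t => [m n|t t' ht ht']; last by rewrite !tscaleB ht ht'.
by rewrite !tscaleE scalerA.
Qed.

Lemma tscale1 : left_id 1 tscale.
Proof.
elim/tens_ind=> [m n|t t' ht ht']; last by rewrite tscaleB ht ht'.
by rewrite tscaleE scale1r.
Qed.

Lemma tscaleDl t : {morph tscale^~ t : r s / r + s}.
Proof.
move=> r s; elim/tens_ind: t => [m n|t t' ht ht'].
  by rewrite !tscaleE scalerDl tens_addl.
by rewrite !tscaleB ht ht' opprD !addrA; congr (_ + _); rewrite addrAC.
Qed.

HB.instance Definition _ := GRing.Zmodule_isLmodule.Build R (tensor M N)
  tscaleA tscale1 tscaleD tscaleDl.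

Lemma scale_tens r m n : r *: tens m n = tens (r *: m) n :> tensor M N.
Proof. exact: tscaleE. Qed.

End TensorMod.

Section QMul.
Variables (M : zmodType).

Definition qmul (q : rat) : tensor M rat -> tensor M rat := tmap idfun (q \*o idfun).

HB.instance Definition _ q := GRing.Additive.on (qmul q).

Lemma qmulE q m p : qmul q (tens m p) = tens m (q * p).
Proof. exact: tmapE. Qed.

End QMul.

Lemma qmulZ (R : pzRingType) (M : lmodType R) q r (t : tensor M rat) :
  qmul q (r *: t) = r *: qmul q t.
Proof.
elim/tens_ind: t => [m n|t t' ht ht'].
  by rewrite scale_tens !qmulE scale_tens.
by rewrite scalerBr !raddfB /= ht ht'.
Qed.

Lemma qmulDl (M : zmodType) p q (t : tensor M rat) :
  qmul (p + q) t = qmul p t + qmul q t.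
Proof.
elim/tens_ind: t => [m n|t t' ht ht']; first by rewrite !qmulE mulrDl tens_addr.
by rewrite !raddfB /= ht ht' opprD !addrA; congr (_ + _); rewrite addrAC.
Qed.

Lemma qmulA (M : zmodType) p q (t : tensor M rat) :
  qmul p (qmul q t) = qmul (p * q) t.
Proof.
elim/tens_ind: t => [m n|t t' ht ht']; first by rewrite !qmulE mulrA.
by rewrite !raddfB /= ht ht'.
Qed.

Lemma qmul1 (M : zmodType) (t : tensor M rat) : qmul 1 t = t.
Proof.
elim/tens_ind: t => [m n|t t' ht ht']; first by rewrite !qmulE mul1r.
by rewrite !raddfB /= ht ht'.
Qed.

(* A module over A and over Q, with commuting actions, is an A (x) Q-module. *)
Section RatAct.
Variables (A : comPzRingType) (X : zmodType).
Variables (act : A -> X -> X) (qact : rat -> X -> X).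
Hypotheses (actB : biadditive act) (qactB : biadditive qact).
Hypotheses (actA : forall a b x, act a (act b x) = act (a * b) x)
           (qactA : forall a b x, qact a (qact b x) = qact (a * b) x).
Hypotheses (act1 : forall x, act 1 x = x) (qact1 : forall x, qact 1 x = x).
Hypothesis actC : forall a q x, qact q (act a x) = act a (qact q x).

Definition rat_act (t : tensor A rat) (x : X) : X :=
  tlift (fun a q => act a (qact q x)) t.

Lemma rat_act_biadd x : biadditive (fun a q => act a (qact q x)).
Proof.
case: actB qactB => [a1 a2] [q1 q2].
by split=> *; rewrite ?a1 // q1 a2.
Qed.

Lemma rat_actE a q x : rat_act (tens a q) x = act a (qact q x).
Proof. exact: (tliftE (rat_act_biadd x)). Qed.

Lemma rat_actBl x : zmod_morphism (rat_act^~ x).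
Proof. exact: tlift_is_additive (rat_act_biadd x). Qed.

Lemma rat_actDl x : {morph rat_act^~ x : s t / s + t}.
Proof.
move=> s t; have e : t = (s + t) - s by rewrite addrC addKr.
by rewrite {2}e rat_actBl addrCA subrr addr0.
Qed.

Lemma rat_actDr : right_distributive rat_act +%R.
Proof.
move=> t x y; rewrite /rat_act -tlift_addf; apply: eq_tlift => a q.
by rewrite qactB.2 actB.2.
Qed.

Lemma rat_actBr t : zmod_morphism (rat_act t).
Proof.
move=> s u; have e : s = (s - u) + u by rewrite subrK.
by rewrite {2}e (rat_actDr t (s - u) u) addrK.
Qed.

Lemma rat_actA s t x : rat_act s (rat_act t x) = rat_act (s * t) x.
Proof.
elim/tens_ind: s => [a p|s s' hs hs']; last first.
  by rewrite (rat_actBl _ s s') mulrBl (rat_actBl _ (s * t)) hs hs'.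
elim/tens_ind: t => [b q|t t' ht ht']; last first.
  by rewrite (rat_actBl _ t t') mulrBr (rat_actBl _ (_ * t)) rat_actBr ht ht'.
by rewrite tensM !rat_actE actC actA qactA.
Qed.

Lemma rat_act1 : left_id 1 rat_act.
Proof. by move=> x; rewrite tens1 rat_actE qact1 act1. Qed.

End RatAct.

(* I^0 M = M and I^(n+1) M = I (I^n M); for M = R^o this is the ideal I^n. *)

Section AdicDef.
Variables (R : comPzRingType) (I : {pred R}) (M : lmodType R).

Fixpoint adic (n : nat) : {pred M} :=
  if n is n'.+1 then
    zspan (fun x => exists a m, [/\ a \in I, m \in adic n' & x = a *: m])
  else predT.

Lemma adic_zmod_closed n : zmod_closed (adic n).
Proof. by case: n => [|n]; [split|exact: zspan_zmod_closed]. Qed.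

HB.instance Definition _ n := GRing.isZmodClosed.Build M (adic n) (adic_zmod_closed n).

Lemma adicS n a m : a \in I -> m \in adic n -> a *: m \in adic n.+1.
Proof. by move=> aI mn; apply: mem_zspan; exists a, m. Qed.

Lemma adicZ n r m : m \in adic n -> r *: m \in adic n.
Proof.
elim: n m => // n IH m; apply: (zspan_sub (f := *:%R r) (T := adic n.+1)).
move=> x [a [y [aI yn ->]]]; rewrite /= scalerA mulrC -scalerA.
by apply: adicS => //; apply: IH.
Qed.

Lemma adic_leS n : {subset adic n.+1 <= adic n}.
Proof.
elim: n => // n IH x; apply: (zspan_sub (f := idfun) (T := adic n.+1)).
by move=> y [a [z [aI zn ->]]]; apply: adicS => //; apply: IH.
Qed.

End AdicDef.

Arguments adic {R} I M n.

Definition scalel (R : pzRingType) (M : lmodType R) (m : M) : R^o -> M :=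
  fun a : R => a *: m.

Lemma scalel_is_additive (R : pzRingType) (M : lmodType R) (m : M) :
  zmod_morphism (scalel m).
Proof. by move=> a b; apply: scalerBl. Qed.

HB.instance Definition _ (R : pzRingType) (M : lmodType R) (m : M) :=
  GRing.isZmodMorphism.Build R^o M (scalel m) (scalel_is_additive m).

Lemma adicM (R : comPzRingType) (I : {pred R}) (M : lmodType R) i j a (m : M) :
  a \in adic I R^o i -> m \in adic I M j -> a *: m \in adic I M (i + j).
Proof.
move=> + mj; elim: i a => [|i IH] a; first by move=> _; apply: adicZ.
apply: (zspan_sub (f := scalel m) (T := adic I M (i.+1 + j))) => x [b [c [bI ci ->]]].
by rewrite /= /scalel -scalerA; apply: adicS => //; apply: IH.
Qed.

Lemma semilinear_adic (R S : comPzRingType) (I : {pred R}) (J : {pred S})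
    (M : lmodType R) (N : lmodType S) (phi : R -> S) (psi : {additive M -> N}) :
  (forall a, a \in I -> phi a \in J) ->
  (forall a m, psi (a *: m) = phi a *: psi m) ->
  forall n x, x \in adic I M n -> psi x \in adic J N n.
Proof.
move=> hI hZ; elim=> // n IH x.
apply: (zspan_sub (f := psi) (T := adic J N n.+1)) => _ [a [m [aI mn ->]]].
by rewrite hZ; apply: adicS; [apply: hI|apply: IH].
Qed.

Section Dprod.
Variable Q : nat -> zmodType.

Definition dprod : Type := forall n, Q n.
HB.instance Definition _ := Choice.on dprod.

Definition dadd (f g : dprod) : dprod := fun n => f n + g n.
Definition dopp (f : dprod) : dprod := fun n => - f n.
Definition dzero : dprod := fun n => 0.

Lemma daddA : associative dadd.
Proof. by move=> f g h; apply/functional_extensionality_dep => n; apply: addrA. Qed.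
Lemma daddC : commutative dadd.
Proof. by move=> f g; apply/functional_extensionality_dep => n; apply: addrC. Qed.
Lemma dadd0 : left_id dzero dadd.
Proof. by move=> f; apply/functional_extensionality_dep => n; apply: add0r. Qed.
Lemma daddN : left_inverse dzero dopp dadd.
Proof. by move=> f; apply/functional_extensionality_dep => n; apply: addNr. Qed.

HB.instance Definition _ := GRing.isZmodule.Build dprod daddA daddC dadd0 daddN.
End Dprod.

Section Completion.
Variables (R : comPzRingType) (I : {pred R}) (M : lmodType R).

Local Notation Mn n := {quot (adic I M n)}.

Definition transition n (x : Mn n.+1) : Mn n := qpi (adic I M n) (repr x).

Definition coherent : {pred dprod (fun n => Mn n)} :=
  fun x => `[< forall n, transition (x n.+1) = x n >].

Lemma transitionE n x : transition (qpi (adic I M n.+1) x) = qpi (adic I M n) x.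
Proof. by apply/qpi_eqP/adic_leS/repr_piB. Qed.

Lemma transition_is_additive n : zmod_morphism (@transition n).
Proof.
move=> x y; rewrite -[x](@qpiK _ (adic I M n.+1)) -[y](@qpiK _ (adic I M n.+1)).
by rewrite -raddfB !transitionE raddfB.
Qed.

HB.instance Definition _ n :=
  GRing.isZmodMorphism.Build (Mn n.+1) (Mn n) (@transition n) (@transition_is_additive n).

Lemma coherent_zmod_closed : zmod_closed coherent.
Proof.
split; first by apply/asboolP => n; apply: raddf0.
move=> x y /asboolP hx /asboolP hy; apply/asboolP => n.
by rewrite [LHS]raddfB /= hx hy.
Qed.

HB.instance Definition _ := GRing.isZmodClosed.Build _ coherent coherent_zmod_closed.

Definition completion : Type := {x : dprod (fun n => Mn n) | x \in coherent}.
HB.instance Definition _ := SubChoice.on completion.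
HB.instance Definition _ := [SubChoice_isSubZmodule of completion by <:].

(* s is a family of representatives of the components of x. *)
Definition clifts (s : nat -> M) (x : completion) :=
  forall n, val x n = qpi (adic I M n) (s n).

Definition clift (x : completion) : nat -> M := fun n => repr (val x n).

Lemma cliftP x : clifts (clift x) x.
Proof. by move=> n; apply/esym/qpiK. Qed.

Lemma clifts_inj s x y : clifts s x -> clifts s y -> x = y.
Proof.
move=> hx hy; apply: val_inj; apply/functional_extensionality_dep => n.
by rewrite hx hy.
Qed.

Lemma cliftsB s t x y : clifts s x -> clifts t y -> clifts (fun n => s n - t n) (x - y).
Proof. by move=> hx hy n; rewrite [RHS]raddfB /= -hx -hy. Qed.

Lemma cliftsD s t x y : clifts s x -> clifts t y -> clifts (fun n => s n + t n) (x + y).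
Proof. by move=> hx hy n; rewrite [RHS]raddfD /= -hx -hy. Qed.

Lemma clifts_coherent s x n : clifts s x -> s n.+1 - s n \in adic I M n.
Proof.
move=> hs; apply/qpi_eqP; rewrite -hs -transitionE -hs.
by have /asboolP h := valP x; apply: h.
Qed.

Definition cclass (s : nat -> M) : dprod (fun n => Mn n) := fun n => qpi (adic I M n) (s n).

Lemma cclass_coherent s : (forall n, s n.+1 - s n \in adic I M n) -> cclass s \in coherent.
Proof. by move=> h; apply/asboolP => n; rewrite transitionE; apply/qpi_eqP. Qed.

Definition cmk s (h : forall n, s n.+1 - s n \in adic I M n) : completion :=
  exist _ (cclass s) (cclass_coherent h).

Lemma cmkP s h : clifts s (@cmk s h). Proof. by []. Qed.

(* The filtration of the inverse limit by the kernels of the projections. *)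
Definition cfilt (n : nat) : {pred completion} := fun x => val x n == 0.

End Completion.

Lemma adic_congr (R : comPzRingType) (I : {pred R}) (M : lmodType R) n
    (a b : R) (x y : M) :
  a - b \in adic I R^o n -> x - y \in adic I M n -> a *: x - b *: y \in adic I M n.
Proof.
move=> hab hxy; have -> : a *: x - b *: y = (a - b) *: x + b *: (x - y).
  by rewrite scalerBl scalerBr addrA subrK.
apply: rpredD; last exact: adicZ.
by have := adicM (j := 0) (m := x) hab isT; rewrite addn0.
Qed.

(* Multiplication lim R/I^n x lim M/I^n M -> lim M/I^n M, componentwise. *)
Section CAct.
Variables (R : comPzRingType) (I : {pred R}) (M : lmodType R).
Implicit Types (a : completion I R^o) (x : completion I M).

Lemma cact_coh a x n :
  (clift a n.+1 : R) *: clift x n.+1 - (clift a n : R) *: clift x n \in adic I M n.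
Proof. by apply: adic_congr; apply: clifts_coherent; apply: cliftP. Qed.

Definition cact a x : completion I M := cmk (cact_coh a x).

Lemma clifts_act (s : nat -> R) t a x : clifts (s : nat -> R^o) a -> clifts t x ->
  clifts (fun n => s n *: t n) (cact a x).
Proof.
move=> hs ht n; rewrite cmkP; apply/qpi_eqP; apply: adic_congr; apply/qpi_eqP.
  by rewrite -hs -cliftP.
by rewrite -ht -cliftP.
Qed.

Lemma cactDl a b x : cact (a + b) x = cact a x + cact b x.
Proof.
have ha := cliftP a; have hb := cliftP b; have hx := cliftP x.
apply: (clifts_inj (clifts_act (cliftsD ha hb) hx)) => n.
rewrite (cliftsD (clifts_act ha hx) (clifts_act hb hx)).
by rewrite -scalerDl.
Qed.

Lemma cactDr a x y : cact a (x + y) = cact a x + cact a y.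
Proof.
have ha := cliftP a; have hx := cliftP x; have hy := cliftP y.
apply: (clifts_inj (clifts_act ha (cliftsD hx hy))) => n.
rewrite (cliftsD (clifts_act ha hx) (clifts_act ha hy)).
by rewrite -scalerDr.
Qed.

End CAct.

Section CRing.
Variables (R : comPzRingType) (I : {pred R}).

Definition cring : Type := completion I R^o.
HB.instance Definition _ := GRing.Zmodule.on cring.

Lemma cone_coh n : (1 : R^o) - 1 \in adic I R^o n.
Proof. by rewrite subrr rpred0. Qed.

Definition cone : cring := cmk cone_coh.
Definition cmul (a b : cring) : cring := cact a b.

Lemma cactA (M : lmodType R) (a b : cring) (x : completion I M) :
  cact a (cact b x) = cact (cmul a b) x.
Proof.
have ha := cliftP a; have hb := cliftP b; have hx := cliftP x.
apply: (clifts_inj (clifts_act ha (clifts_act hb hx))) => n.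
rewrite (clifts_act (clifts_act ha hb) hx); congr (qpi _ _).
by rewrite scalerA.
Qed.

Lemma cact1 (M : lmodType R) (x : completion I M) : cact cone x = x.
Proof.
have hx := cliftP x; have h1 : clifts (fun=> 1 : R^o) cone by [].
apply: (clifts_inj (clifts_act h1 hx)) => n.
by rewrite hx scale1r.
Qed.

Lemma cmulA : associative cmul.
Proof. by move=> a b c; apply: cactA. Qed.

Lemma cmulC : commutative cmul.
Proof.
move=> a b; have ha := cliftP a; have hb := cliftP b.
apply: (clifts_inj (clifts_act ha hb)) => n.
rewrite (clifts_act hb ha); congr (qpi _ _); exact: mulrC.
Qed.

Lemma cmul1 : left_id cone cmul. Proof. exact: cact1. Qed.
Lemma cmulDl : left_distributive cmul +%R. Proof. by move=> a b c; apply: cactDl. Qed.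

HB.instance Definition _ := GRing.Zmodule_isComPzRing.Build cring
  cmulA cmulC cmul1 cmulDl.

End CRing.

(* Additive maps compatible with the adic filtrations. *)
Record adicHom (R S : comPzRingType) (I : {pred R}) (J : {pred S})
    (M : lmodType R) (N : lmodType S) := AdicHom {
  ahom :> {additive M -> N};
  ahomP : forall n x, x \in adic I M n -> ahom x \in adic J N n
}.

Section CMap.
Variables (R S : comPzRingType) (I : {pred R}) (J : {pred S}).
Variables (M : lmodType R) (N : lmodType S) (psi : adicHom I J M N).

Lemma cmap_coh (x : completion I M) n :
  psi (clift x n.+1) - psi (clift x n) \in adic J N n.
Proof. by rewrite -raddfB; apply/ahomP/clifts_coherent/cliftP. Qed.

Definition cmap (x : completion I M) : completion J N := cmk (cmap_coh x).

Lemma clifts_map s x : clifts s x -> clifts (psi \o s) (cmap x).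
Proof.
move=> hs n; rewrite cmkP; apply/qpi_eqP; rewrite /= -raddfB.
by apply: ahomP; apply/qpi_eqP; rewrite -hs -cliftP.
Qed.

Lemma cmap_is_additive : zmod_morphism cmap.
Proof.
move=> x y; have hx := cliftP x; have hy := cliftP y.
apply: (clifts_inj (clifts_map (cliftsB hx hy))) => n.
rewrite (cliftsB (clifts_map hx) (clifts_map hy)); congr (qpi _ _).
by rewrite /= raddfB.
Qed.

HB.instance Definition _ := GRing.isZmodMorphism.Build _ _ cmap cmap_is_additive.

End CMap.

(* The associated graded: finitely supported families of classes in
   I^n M / I^(n+1) M, seen inside M / I^(n+1) M. *)

Section Graded.
Variables (R : comPzRingType) (I : {pred R}) (M : lmodType R).

Local Notation Mn n := {quot (adic I M n)}.

Definition gr_pred : {pred dprod (fun n => Mn n.+1)} := fun x =>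
  `[< (forall n, exists2 m, m \in adic I M n & x n = qpi (adic I M n.+1) m) /\
      exists N, forall n, (N <= n)%N -> x n = 0 >].

Lemma gr_zmod_closed : zmod_closed gr_pred.
Proof.
split.
  apply/asboolP; split=> [n|]; last by exists 0%N.
  by exists 0; rewrite ?rpred0 ?raddf0.
move=> x y /asboolP[hx [N hN]] /asboolP[hy [N' hN']]; apply/asboolP; split=> [n|].
  have [m mn e] := hx n; have [m' mn' e'] := hy n; exists (m - m').
    by rewrite rpredB.
  by rewrite [RHS]raddfB /= -e -e'.
exists (maxn N N') => n; rewrite geq_max => /andP[/hN e /hN' e'].
by rewrite -[LHS]/(x n - y n) e e' subr0.
Qed.

HB.instance Definition _ := GRing.isZmodClosed.Build _ gr_pred gr_zmod_closed.

Definition gr : Type := {x : dprod (fun n => Mn n.+1) | x \in gr_pred}.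
HB.instance Definition _ := SubChoice.on gr.
HB.instance Definition _ := [SubChoice_isSubZmodule of gr by <:].

Definition glifts (s : nat -> M) (x : gr) :=
  forall n, s n \in adic I M n /\ val x n = qpi (adic I M n.+1) (s n).

Definition glift (x : gr) : nat -> M := fun n => repr (val x n).

Lemma gliftP x : glifts (glift x) x.
Proof.
move=> n; split; last exact/esym/qpiK.
have /asboolP[/(_ n)[m mn e] _] := valP x.
rewrite /glift e -[repr _](subrK m) rpredD //.
exact/adic_leS/repr_piB.
Qed.

Lemma glifts_inj s x y : glifts s x -> glifts s y -> x = y.
Proof.
move=> hx hy; apply: val_inj; apply/functional_extensionality_dep => n.
by rewrite (hx n).2 (hy n).2.
Qed.

Lemma gliftsB s t x y : glifts s x -> glifts t y -> glifts (fun n => s n - t n) (x - y).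
Proof.
move=> hx hy n; split; first by rewrite rpredB ?(hx n).1 ?(hy n).1.
by rewrite [RHS]raddfB /= -(hx n).2 -(hy n).2.
Qed.

Lemma gliftsD s t x y : glifts s x -> glifts t y -> glifts (fun n => s n + t n) (x + y).
Proof.
move=> hx hy n; split; first by rewrite rpredD ?(hx n).1 ?(hy n).1.
by rewrite [RHS]raddfD /= -(hx n).2 -(hy n).2.
Qed.

Lemma glifts_fin s x : glifts s x -> exists N, forall n, (N <= n)%N -> s n \in adic I M n.+1.
Proof.
move=> hs; have /asboolP[_ [N hN]] := valP x; exists N => n /hN.
by rewrite (hs n).2 => /qpi_eq0P.
Qed.

Lemma glifts_congr s t x n : glifts s x -> glifts t x -> s n - t n \in adic I M n.+1.
Proof. by move=> hs ht; apply/qpi_eqP; rewrite -(hs n).2 -(ht n).2. Qed.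

Definition gclass (s : nat -> M) : dprod (fun n => Mn n.+1) := fun n => qpi (adic I M n.+1) (s n).

Definition gok (s : nat -> M) := (forall n, s n \in adic I M n) /\
  exists N, forall n, (N <= n)%N -> s n \in adic I M n.+1.

Lemma gclass_pred s : gok s -> gclass s \in gr_pred.
Proof.
move=> [h1 [N hN]]; apply/asboolP; split=> [n|]; first by exists (s n).
by exists N => n /hN /qpi_eq0P.
Qed.

Definition gmk s (h : gok s) : gr := exist _ (gclass s) (gclass_pred h).

Lemma gmkP s h : glifts s (@gmk s h).
Proof. by move=> n; split; first exact: h.1. Qed.

Lemma glifts_change s t x : glifts s x -> (forall n, t n \in adic I M n) ->
  (forall n, s n - t n \in adic I M n.+1) -> glifts t x.
Proof.
move=> hs ht hst n; split=> //; rewrite (hs n).2; exact/qpi_eqP.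
Qed.

Definition gdeg (n : nat) : {pred gr} :=
  fun x => `[< forall k, k != n -> val x k = 0 >].

End Graded.

Section Conv.
Variables (R : comPzRingType) (M : lmodType R).

(* Product of a in gr(R) and x in gr(M) on representatives: degree n part. *)
Definition conv (a : nat -> R) (x : nat -> M) (n : nat) : M :=
  \sum_(i < n.+1) a i *: x (n - i)%N.

End Conv.

Lemma convA (R : comPzRingType) (M : lmodType R) (a b : nat -> R) (x : nat -> M) n :
  conv (conv a (b : nat -> R^o)) x n = conv a (conv b x) n.
Proof.
rewrite /conv.
transitivity (\sum_(i < n.+1) \sum_(j < n.+1 | (j <= i)%N)
    (a j * b (i - j)%N) *: x (n - i)%N).
  apply: eq_bigr => i _; rewrite scaler_suml.
  by rewrite (big_ord_widen n.+1 (fun j => (a j *: (b (i - j)%N : R^o)) *: x (n - i)%N)).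
rewrite (exchange_big_dep predT) //=; apply: eq_bigr => j _.
rewrite scaler_sumr.
rewrite -(big_mkord (fun i => (j <= i)%N) (fun i => (a j * b (i - j)%N) *: x (n - i)%N)).
rewrite -(big_mkord predT (fun i => a j *: (b i *: x (n - j - i)%N))).
have jn : (j <= n)%N by rewrite -ltnS.
rewrite (@big_cat_nat _ _ _ j) //=; last exact: leqW.
rewrite big_nat_cond big1 ?add0r; last first.
  by move=> i /andP[/andP[_ h]]; rewrite leqNgt h.
rewrite -{1}[nat_of_ord j]add0n big_addn subSn //.
rewrite big_mkcond /=; apply: eq_bigr => i _.
by rewrite leq_addl addnK scalerA -subnDA (addnC i).
Qed.

Lemma convC (R : comPzRingType) (a b : nat -> R) n :
  conv a (b : nat -> R^o) n = conv b (a : nat -> R^o) n.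
Proof.
rewrite /conv (reindex_inj rev_ord_inj) /=; apply: eq_bigr => i _.
by rewrite subSS subKn -1?ltnS // [LHS]mulrC.
Qed.

Section GAct.
Variables (R : comPzRingType) (I : {pred R}) (M : lmodType R).
Implicit Types (a : gr I R^o) (x : gr I M).

Lemma conv_adic (s : nat -> R) (t : nat -> M) n :
  (forall i, s i \in adic I R^o i) -> (forall i, t i \in adic I M i) ->
  conv s t n \in adic I M n.
Proof.
move=> hs ht; apply: rpred_sum => i _.
have := adicM (hs i) (ht (n - i)%N).
by rewrite subnKC // -ltnS.
Qed.

Lemma conv_congr (s s' : nat -> R) (t t' : nat -> M) n :
  (forall i, s i \in adic I R^o i) -> (forall i, t' i \in adic I M i) ->
  (forall i, (s i : R^o) - s' i \in adic I R^o i.+1) ->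
  (forall i, t i - t' i \in adic I M i.+1) ->
  conv s t n - conv s' t' n \in adic I M n.+1.
Proof.
move=> hs ht hss htt; rewrite -sumrB; apply: rpred_sum => i _.
have -> : s i *: t (n - i)%N - s' i *: t' (n - i)%N =
    s i *: (t (n - i)%N - t' (n - i)%N) + (s i - s' i) *: t' (n - i)%N.
  by rewrite scalerBl scalerBr addrA subrK.
have e : (i + (n - i) = n)%N by rewrite subnKC // -ltnS.
apply: rpredD.
  by have := adicM (hs i) (htt (n - i)%N); rewrite addnS e.
by have := adicM (hss i) (ht (n - i)%N); rewrite addSn e.
Qed.

Lemma gact_ok a x : gok I (conv (glift a : nat -> R) (glift x)).
Proof.
have ha := gliftP a; have hx := gliftP x.
split=> [n|]; first by apply: conv_adic => i; [have [] := ha i|have [] := hx i].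
have [N hN] := glifts_fin ha; have [N' hN'] := glifts_fin hx.
exists (N + N')%N => n hn; apply: rpred_sum => i _.
have e : (i + (n - i) = n)%N by rewrite subnKC // -ltnS.
case: (leqP N i) => h.
  by have := adicM (hN _ h) (hx (n - i)%N).1; rewrite addSn e.
have h' : (N' <= n - i)%N.
  by rewrite leq_subRL -1?ltnS //; apply: leq_trans hn; rewrite leq_add2r ltnW.
by have := adicM (ha i).1 (hN' _ h'); rewrite addnS e.
Qed.

Definition gact a x : gr I M := gmk (gact_ok a x).

Lemma glifts_act (s : nat -> R) t a x : glifts (s : nat -> R^o) a -> glifts t x ->
  glifts (conv s t) (gact a x).
Proof.
move=> hs ht; have ha := gliftP a; have hx := gliftP x.
apply: (glifts_change (gmkP (gact_ok a x))) => n.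
  by apply: conv_adic => i; [have [] := hs i|have [] := ht i].
apply: conv_congr => i.
- by have [] := ha i.
- by have [] := ht i.
- exact: glifts_congr ha hs.
exact: glifts_congr hx ht.
Qed.

Lemma glifts_eq s t x : glifts s x -> s =1 t -> glifts t x.
Proof. by move=> hs e n; rewrite -e. Qed.

Lemma gactDl a b x : gact (a + b) x = gact a x + gact b x.
Proof.
have ha := gliftP a; have hb := gliftP b; have hx := gliftP x.
apply: (glifts_inj (glifts_act (gliftsD ha hb) hx)).
apply: glifts_eq (gliftsD (glifts_act ha hx) (glifts_act hb hx)) _ => n.
by rewrite /conv -big_split; apply: eq_bigr => i _; rewrite /= scalerDl.
Qed.

Lemma gactDr a x y : gact a (x + y) = gact a x + gact a y.
Proof.
have ha := gliftP a; have hx := gliftP x; have hy := gliftP y.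
apply: (glifts_inj (glifts_act ha (gliftsD hx hy))).
apply: glifts_eq (gliftsD (glifts_act ha hx) (glifts_act ha hy)) _ => n.
by rewrite /conv -big_split; apply: eq_bigr => i _; rewrite /= scalerDr.
Qed.

End GAct.

Section GRingStruct.
Variables (R : comPzRingType) (I : {pred R}).

Definition grring : Type := gr I R^o.
HB.instance Definition _ := GRing.Zmodule.on grring.

Definition gone_seq (n : nat) : R^o := (n == 0%N)%:R.

Lemma gone_ok : gok I gone_seq.
Proof.
split=> [[|n]|]; rewrite /gone_seq ?rpred0 //.
by exists 1%N => -[|n] // _; rewrite rpred0.
Qed.

Definition gone : grring := gmk gone_ok.
Definition gmul (a b : grring) : grring := gact a b.

Lemma gactA (M : lmodType R) (a b : grring) (x : gr I M) :
  gact a (gact b x) = gact (gmul a b) x.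
Proof.
have ha := gliftP a; have hb := gliftP b; have hx := gliftP x.
apply: (glifts_inj (glifts_act ha (glifts_act hb hx))).
apply: glifts_eq (glifts_act (glifts_act ha hb) hx) _ => n.
exact: convA.
Qed.

Lemma gact1 (M : lmodType R) (x : gr I M) : gact gone x = x.
Proof.
have hx := gliftP x; apply: (glifts_inj (glifts_act (gmkP gone_ok) hx)).
apply: glifts_eq hx _ => n; rewrite /conv big_ord_recl /= scale1r subn0.
by rewrite big1 ?addr0 // => i _; rewrite /gone_seq /= scale0r.
Qed.

Lemma gmulA : associative gmul.
Proof. by move=> a b c; apply: gactA. Qed.

Lemma gmulC : commutative gmul.
Proof.
move=> a b; have ha := gliftP a; have hb := gliftP b.
apply: (glifts_inj (glifts_act ha hb)).
by apply: glifts_eq (glifts_act hb ha) _ => n; apply: convC.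
Qed.

Lemma gmul1 : left_id gone gmul. Proof. exact: gact1. Qed.
Lemma gmulDl : left_distributive gmul +%R. Proof. by move=> a b c; apply: gactDl. Qed.

HB.instance Definition _ := GRing.Zmodule_isComPzRing.Build grring
  gmulA gmulC gmul1 gmulDl.

End GRingStruct.

Section GMap.
Variables (R S : comPzRingType) (I : {pred R}) (J : {pred S}).
Variables (M : lmodType R) (N : lmodType S) (psi : adicHom I J M N).

Lemma gmap_ok (x : gr I M) : gok J (psi \o glift x).
Proof.
have hx := gliftP x; split=> [n|]; first by apply: ahomP; have [] := hx n.
by have [k hk] := glifts_fin hx; exists k => n /hk; apply: ahomP.
Qed.

Definition gmap (x : gr I M) : gr J N := gmk (gmap_ok x).

Lemma glifts_map s x : glifts s x -> glifts (psi \o s) (gmap x).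
Proof.
move=> hs; apply: (glifts_change (gmkP (gmap_ok x))) => n.
  by apply: ahomP; have [] := hs n.
by have := ahomP psi (glifts_congr n (gliftP x) hs); rewrite raddfB.
Qed.

Lemma gmap_is_additive : zmod_morphism gmap.
Proof.
move=> x y; have hx := gliftP x; have hy := gliftP y.
apply: (glifts_inj (glifts_map (gliftsB hx hy))).
apply: glifts_eq (gliftsB (glifts_map hx) (glifts_map hy)) _ => n.
by rewrite /= raddfB.
Qed.

HB.instance Definition _ := GRing.isZmodMorphism.Build _ _ gmap gmap_is_additive.

End GMap.

Section RingMaps.
Variables (R S : comPzRingType) (I : {pred R}) (J : {pred S}).
Variables (phi : {rmorphism R -> S}) (phiI : forall a, a \in I -> phi a \in J).

Definition rmap_o : R^o -> S^o := phi.

Lemma rmap_o_is_additive : zmod_morphism rmap_o. Proof. exact: (raddfB phi). Qed.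
HB.instance Definition _ := GRing.isZmodMorphism.Build R^o S^o rmap_o rmap_o_is_additive.

Lemma rmap_o_adic n x : x \in adic I R^o n -> rmap_o x \in adic J S^o n.
Proof. apply: (semilinear_adic (phi := phi)) => // a m; exact: (rmorphM phi). Qed.

Definition ring_adicHom : adicHom I J R^o S^o := AdicHom rmap_o_adic.

Definition cring_map : cring I -> cring J := cmap ring_adicHom.

HB.instance Definition _ := GRing.isZmodMorphism.Build (cring I) (cring J) cring_map
  (cmap_is_additive ring_adicHom).

Lemma cring_map_monoid : monoid_morphism cring_map.
Proof.
split=> [|a b].
  have h1 : clifts (fun=> 1 : R^o) (1 : cring I) by [].
  apply: (clifts_inj (clifts_map ring_adicHom h1)) => n.
  by congr (qpi _ _); rewrite /= /rmap_o rmorph1.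
have ha := cliftP a; have hb := cliftP b.
apply: (clifts_inj (clifts_map ring_adicHom (clifts_act ha hb))) => n.
rewrite (clifts_act (clifts_map ring_adicHom ha) (clifts_map ring_adicHom hb)).
congr (qpi _ _); apply/esym; exact: (rmorphM phi).
Qed.

HB.instance Definition _ := GRing.isMonoidMorphism.Build (cring I) (cring J) cring_map
  cring_map_monoid.

Definition grring_map : grring I -> grring J := gmap ring_adicHom.

HB.instance Definition _ := GRing.isZmodMorphism.Build (grring I) (grring J) grring_map
  (gmap_is_additive ring_adicHom).

Lemma grring_map_monoid : monoid_morphism grring_map.
Proof.
split=> [|a b].
  apply: (glifts_inj (glifts_map ring_adicHom (gmkP (gone_ok I)))).
  apply: (glifts_eq (gmkP (gone_ok J))) => n.
  by rewrite /= /rmap_o /gone_seq rmorph_nat.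
have ha := gliftP a; have hb := gliftP b.
apply: (glifts_inj (glifts_map ring_adicHom (glifts_act ha hb))).
apply: (glifts_eq (glifts_act (glifts_map ring_adicHom ha) (glifts_map ring_adicHom hb))) => n.
rewrite /conv /= /rmap_o rmorph_sum; apply: eq_bigr => i _.
by apply/esym; exact: (rmorphM phi).
Qed.

HB.instance Definition _ := GRing.isMonoidMorphism.Build (grring I) (grring J) grring_map
  grring_map_monoid.

End RingMaps.

Section QModules.
Variables (R : comPzRingType) (I : {pred R}) (M : lmodType R).

Lemma qmul_adic q n (x : tensor M rat) :
  x \in adic I (tensor M rat) n -> qmul q x \in adic I (tensor M rat) n.
Proof.
by apply: (semilinear_adic (phi := id) (psi := qmul q)) => // a m; exact: qmulZ.
Qed.

Definition qmul_hom q : adicHom I I (tensor M rat) (tensor M rat) :=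
  AdicHom (ahom := qmul q) (@qmul_adic q).

(* Copy of the completion carrying the (R^ (x) Q)-module structure. *)
Definition completionQ : Type := completion I (tensor M rat).
HB.instance Definition _ := GRing.Zmodule.on completionQ.

Definition cactQ (a : cring I) (x : completionQ) : completionQ := cact a x.
Definition cqmul (q : rat) (x : completionQ) : completionQ := cmap (qmul_hom q) x.

(* (a (x) q) . x = q (a x) *)
Definition cscale : tensor (cring I) rat -> completionQ -> completionQ :=
  rat_act cactQ cqmul.

Lemma cact_biadd : biadditive cactQ.
Proof. by split=> *; [apply: cactDl|apply: cactDr]. Qed.

Lemma cactQA a b x : cactQ a (cactQ b x) = cactQ (a * b) x. Proof. exact: cactA. Qed.
Lemma cactQ1 x : cactQ 1 x = x. Proof. exact: cact1. Qed.

Lemma cqmul_biadd : biadditive cqmul.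
Proof.
split=> [p q x|q x y]; last exact: raddfD.
have hx := cliftP x.
apply: (clifts_inj (clifts_map (qmul_hom (p + q)) hx)) => n.
rewrite (cliftsD (clifts_map (qmul_hom p) hx) (clifts_map (qmul_hom q) hx)).
by congr (qpi _ _); rewrite /= qmulDl.
Qed.

Lemma cqmulA p q (x : completionQ) :
  cqmul p (cqmul q x) = cqmul (p * q) x.
Proof.
have hx := cliftP x.
apply: (clifts_inj (clifts_map (qmul_hom p) (clifts_map (qmul_hom q) hx))) => n.
by rewrite (clifts_map (qmul_hom (p * q)) hx); congr (qpi _ _); rewrite /= qmulA.
Qed.

Lemma cqmul1 (x : completionQ) : cqmul 1 x = x.
Proof.
have hx := cliftP x.
apply: (clifts_inj (clifts_map (qmul_hom 1) hx)) => n.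
by rewrite hx /= qmul1.
Qed.

Lemma cqmulC (a : cring I) q (x : completionQ) :
  cqmul q (cactQ a x) = cactQ a (cqmul q x).
Proof.
have ha := cliftP a; have hx := cliftP x.
apply: (clifts_inj (clifts_map (qmul_hom q) (clifts_act ha hx))) => n.
by rewrite (clifts_act ha (clifts_map (qmul_hom q) hx)); congr (qpi _ _); rewrite /= qmulZ.
Qed.

HB.instance Definition _ := GRing.Zmodule_isLmodule.Build (tensor (cring I) rat) completionQ
  (rat_actA cact_biadd cqmul_biadd cactQA cqmulA cqmulC)
  (rat_act1 cact_biadd cqmul_biadd cactQ1 cqmul1)
  (rat_actDr cact_biadd cqmul_biadd)
  (rat_actDl cact_biadd cqmul_biadd).

(* Copy of gr(M (x) Q) carrying the (gr(R) (x) Q)-module structure. *)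
Definition grQ : Type := gr I (tensor M rat).
HB.instance Definition _ := GRing.Zmodule.on grQ.

Definition gactQ (a : grring I) (x : grQ) : grQ := gact a x.
Definition gqmul (q : rat) (x : grQ) : grQ := gmap (qmul_hom q) x.

Definition gscaleQ : tensor (grring I) rat -> grQ -> grQ := rat_act gactQ gqmul.

Lemma gact_biadd : biadditive gactQ.
Proof. by split=> *; [apply: gactDl|apply: gactDr]. Qed.

Lemma gactQA a b x : gactQ a (gactQ b x) = gactQ (a * b) x. Proof. exact: gactA. Qed.
Lemma gactQ1 x : gactQ 1 x = x. Proof. exact: gact1. Qed.

Lemma gqmul_biadd : biadditive gqmul.
Proof.
split=> [p q x|q x y]; last exact: raddfD.
have hx := gliftP x.
apply: (glifts_inj (glifts_map (qmul_hom (p + q)) hx)).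
apply: (glifts_eq (gliftsD (glifts_map (qmul_hom p) hx) (glifts_map (qmul_hom q) hx))) => n.
by rewrite /= qmulDl.
Qed.

Lemma gqmulA p q (x : grQ) :
  gqmul p (gqmul q x) = gqmul (p * q) x.
Proof.
have hx := gliftP x.
apply: (glifts_inj (glifts_map (qmul_hom p) (glifts_map (qmul_hom q) hx))).
by apply: (glifts_eq (glifts_map (qmul_hom (p * q)) hx)) => n; rewrite /= qmulA.
Qed.

Lemma gqmul1 (x : grQ) : gqmul 1 x = x.
Proof.
have hx := gliftP x.
apply: (glifts_inj (glifts_map (qmul_hom 1) hx)).
by apply: (glifts_eq hx) => n; rewrite /= qmul1.
Qed.

Lemma gqmulC (a : grring I) q (x : grQ) :
  gqmul q (gactQ a x) = gactQ a (gqmul q x).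
Proof.
have ha := gliftP a; have hx := gliftP x.
apply: (glifts_inj (glifts_map (qmul_hom q) (glifts_act ha hx))).
apply: (glifts_eq (glifts_act ha (glifts_map (qmul_hom q) hx))) => n.
by rewrite /conv /= raddf_sum; apply: eq_bigr => i _; rewrite /= qmulZ.
Qed.

HB.instance Definition _ := GRing.Zmodule_isLmodule.Build (tensor (grring I) rat) grQ
  (rat_actA gact_biadd gqmul_biadd gactQA gqmulA gqmulC)
  (rat_act1 gact_biadd gqmul_biadd gactQ1 gqmul1)
  (rat_actDr gact_biadd gqmul_biadd)
  (rat_actDl gact_biadd gqmul_biadd).

End QModules.

(* The image of F (x) Q in M (x) Q. *)
Definition tensQ_sub (M : zmodType) (F : {pred M}) : {pred tensor M rat} :=
  zspan (fun t => exists m q, m \in F /\ t = tens m q).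

Definition surj (X Y : Type) (f : X -> Y) : Prop := forall y, exists x, f x = y.

Definition ring_hom (A C : pzRingType) (phi : A -> C) : Prop :=
  zmod_morphism phi /\ monoid_morphism phi.

Definition covers (A C : pzRingType) (M : lmodType A) (N : lmodType C)
    (phi : A -> C) (psi : M -> N) : Prop :=
  zmod_morphism psi /\ forall a m, psi (a *: m) = phi a *: psi m.

(* For families of subgroups indexed by nat: filtrations or gradings. *)
Definition respects (X Y : Type) (F : nat -> {pred X}) (F' : nat -> {pred Y})
    (f : X -> Y) : Prop := forall n x, x \in F n -> f x \in F' n.

Definition iso_respects (X Y : Type) (F : nat -> {pred X}) (F' : nat -> {pred Y})
    (f : X -> Y) : Prop :=
  bijective f /\ forall n x, (f x \in F' n) = (x \in F n).

Arguments cfilt {R} I M n.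
Arguments gdeg {R} I M n.

Section Main.
Variable G : groupType.

Local Notation R := (gring (Gab G)).
Local Notation R0 := (gring (Gabf G)).
Local Notation I := (aug_ideal (Gab G)).
Local Notation I0 := (aug_ideal (Gabf G)).

Lemma nu_tilde_aug (r : R) : r \in I -> nu_tilde r \in I0.
Proof. exact: aug_ideal_map. Qed.

Definition nu_hatQ : tensor (cring I) rat -> tensor (cring I0) rat :=
  tmap (cring_map nu_tilde_aug) idfun.
Definition nu_grQ : tensor (grring I) rat -> tensor (grring I0) rat :=
  tmap (grring_map nu_tilde_aug) idfun.

Definition kappaQ : tensor (Alex G) rat -> tensor (AlexQ G) rat :=
  tmap (@kappa G) idfun.

HB.instance Definition _ := GRing.Additive.on kappaQ.

Lemma kappaQ_semilinear (r : R) t : kappaQ (r *: t) = nu_tilde r *: kappaQ t.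
Proof.
elim/tens_ind: t => [b q|t t' ht ht'].
  by rewrite scale_tens [LHS]tmapE /= kappa_semilinear [kappaQ _]tmapE scale_tens.
by rewrite scalerBr !raddfB /= ht ht'.
Qed.

Lemma kappaQ_adic n t :
  t \in adic I (tensor (Alex G) rat) n -> kappaQ t \in adic I0 (tensor (AlexQ G) rat) n.
Proof. exact: (semilinear_adic nu_tilde_aug kappaQ_semilinear). Qed.

Definition kappaQ_hom :
    adicHom I I0 (tensor (Alex G) rat) (tensor (AlexQ G) rat) :=
  AdicHom (ahom := kappaQ) kappaQ_adic.

Definition kappa_hatQ : completionQ I (Alex G) -> completionQ I0 (AlexQ G) :=
  cmap kappaQ_hom.
Definition kappa_grQ : grQ I (Alex G) -> grQ I0 (AlexQ G) := gmap kappaQ_hom.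

Definition filt_R n : {pred tensor (cring I) rat} := tensQ_sub (cfilt I R^o n : {pred cring I}).
Definition filt_R0 n : {pred tensor (cring I0) rat} := tensQ_sub (cfilt I0 R0^o n : {pred cring I0}).
Definition filt_B n : {pred completionQ I (Alex G)} := cfilt I (tensor (Alex G) rat) n.
Definition filt_BQ n : {pred completionQ I0 (AlexQ G)} :=
  cfilt I0 (tensor (AlexQ G) rat) n.
Definition deg_R n : {pred tensor (grring I) rat} := tensQ_sub (gdeg I R^o n : {pred grring I}).
Definition deg_R0 n : {pred tensor (grring I0) rat} := tensQ_sub (gdeg I0 R0^o n : {pred grring I0}).
Definition deg_B n : {pred grQ I (Alex G)} := gdeg I (tensor (Alex G) rat) n.
Definition deg_BQ n : {pred grQ I0 (AlexQ G)} := gdeg I0 (tensor (AlexQ G) rat) n.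

End Main.

(* Main.v *)
Require Import Defs.
From HB Require Import structures.
From mathcomp Require Import all_boot all_algebra.
From mathcomp Require Import boolp.
From mathcomp Require Import ring.
From mathcomp.multinomials Require Import monalg.

Set Implicit Arguments.
Unset Strict Implicit.
Unset Printing Implicit Defensive.

Import GRing.Theory Num.Theory.
Local Open Scope ring_scope.

(** Write T for the torsion subgroup of A = G_ab and D for the intersection of
    the submodules I^n M, where M = B(G) (x) Q.  The reason for the theorem is
    that kappa (x) Q is onto and only kills elements of D, whereas neither the
    completion nor the associated graded module can see D.

    Why T acts trivially modulo D ([tors_act_core]): if a has order dividing m
    and u = a - 1, then 0 = (1 + u)^m - 1 is m u plus a multiple of u^2.  Since m
    is invertible on M this gives u M = u^2 M = u^3 M = ..., and u lies in I.

    Why kappa (x) Q is injective modulo D ([kappaQ_ker]): let H = G'_Q.  For g in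
    H and k in G', the commutator [k, g] = k^-1 k^g has class (g^-1 - 1) k in
    B(G), and g has torsion image in A, so this class lies in D after tensoring
    with Q.  For h in H some power h^m is in G', and modulo D the
    class of [h^m, g] is m times that of [h, g]; dividing by m, the class of
    [h, g] is in D as well ([alexq_comm_core]).  So [H, H] maps into D.  Now an
    element of M is a fraction b / d, and if kappa (x) Q kills it, then some
    positive multiple of b is represented by an element of [H, H].  This uses
    that b (x) q can vanish only if b is torsion ([tens_eq0]).

    Why kappa (x) Q is onto ([kappaQ_surj]): an element g of H equals g^m / m in
    B_Q(G) (x) Q, and g^m is in G' for a suitable m.

    The ring map from Z[G_ab] to Z[G_abf] is onto and respects augmentation, so
    kappa (x) Q maps I^n M onto I_0^n N, for N = B_Q(G) (x) Q
    ([kappaQ_onto]).  As its kernel lies in every I^n M, the inverse image of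
    I_0^n N is exactly I^n M ([kappaQ_strict]).  Maps with these two properties
    induce isomorphisms of completions, filtrations included, and of associated
    graded modules.  The first property alone gives surjectivity, which is what
    is claimed of the ring maps. *)

(** * Tensoring with the rationals *)

Section TensorRat.
Variable M : zmodType.

Definition tensl (q : rat) (m : M) : tensor M rat := tens m q.
Definition tensr (m : M) (q : rat) : tensor M rat := tens m q.

Lemma tensl_is_additive q : zmod_morphism (tensl q).
Proof.
move=> x y; apply/eqP; rewrite eq_sym subr_eq; apply/eqP.
by rewrite /tensl -tens_addl subrK.
Qed.

Lemma tensr_is_additive m : zmod_morphism (tensr m).
Proof.
move=> p q; apply/eqP; rewrite eq_sym subr_eq; apply/eqP.
by rewrite /tensr -tens_addr subrK.
Qed.

HB.instance Definition _ q :=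
  GRing.isZmodMorphism.Build M (tensor M rat) (tensl q) (tensl_is_additive q).
HB.instance Definition _ m :=
  GRing.isZmodMorphism.Build rat (tensor M rat) (tensr m) (tensr_is_additive m).

Lemma tens_mulrz (m : M) (q : rat) k : tens (m *~ k) q = tens m (q *~ k).
Proof.
rewrite -[LHS]/(tensl q _) -[RHS]/(tensr m _).
by rewrite (raddfMz (tensl q)) (raddfMz (tensr m)).
Qed.

Lemma tens_mulrn (m : M) (q : rat) n : tens (m *+ n) q = tens m (q *+ n).
Proof. by rewrite !pmulrn tens_mulrz. Qed.

(** Fractions have common denominators. *)
Lemma tens_pure (t : tensor M rat) :
  exists m (d : nat), (0 < d)%N /\ t = tens m d%:R^-1.
Proof.
elim/tens_ind: t => [m q|s t [m [d [d0 ->]]] [m' [d' [d'0 ->]]]].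
  exists (m *~ numq q), `|denq q|%N; split; first by rewrite absz_gt0 denq_neq0.
  rewrite tens_mulrz; congr tens.
  rewrite -[LHS]divq_num_den -[RHS]mulrzl; congr (_ * _^-1).
  by rewrite [RHS]pmulrn gez0_abs // ltW ?denq_gt0.
exists (m *+ d' - m' *+ d), (d * d')%N; rewrite muln_gt0 d0; split=> //.
rewrite -[RHS]/(tensl _ _) raddfB /= /tensl !tens_mulrn.
have nz (n : nat) : (0 < n)%N -> n%:R != 0 :> rat by rewrite pnatr_eq0 -lt0n.
congr (tens _ _ - tens _ _); rewrite -[RHS]mulr_natr natrM invfM.
  by rewrite mulfVK ?nz.
by rewrite [RHS]mulrAC mulVf ?nz // mul1r.
Qed.

(** On pairs (m, q) with N q an integer this is the biadditive map m * (N q); on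
    other pairs it is a junk value. *)
Definition scaled_num (N : int) (p : M * rat) : M := p.1 *~ numq (p.2 * N%:~R).

(** The rationals are the union of the groups Z / N, and a consequence of the
    bilinearity relations involves only finitely many rationals, hence already
    holds over one of these groups, where it can be evaluated.  Quantifying
    over the multiples N k allows two bounds to be combined. *)
Lemma scaled_num_bilin (c : {malg int[(M * rat)%type]}) :
  c \in zspan (@bilin_rel M rat) ->
  exists2 N : int, N != 0 & forall k : int, fext (scaled_num (N * k)) c = 0.
Proof.
move/asboolP; elim=> [|_ [m m' q|m q q']|x y _ [N N0 hx] _ [N' N'0 hy]].
- by exists 1 => // k; rewrite raddf0.
- exists 1 => // k; rewrite raddfB raddfD /= !fextU /scaled_num /=.
  by rewrite mulrzDl subrr.
- exists (denq q * denq q'); first by rewrite mulf_neq0 ?denq_neq0.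
  move=> k; rewrite raddfB raddfD /= !fextU /scaled_num /= mulrDl.
  rewrite !intrM [denq q]lock !mulrA (mulrAC q') -lock -!numqE.
  by rewrite -!intrM -intrD !numq_int mulrzDr subrr.
exists (N * N'); first by rewrite mulf_neq0.
move=> k; rewrite raddfB /= -mulrA hx.
by rewrite mulrCA hy subrr.
Qed.

(** Only torsion dies rationally: evaluate the trivial tensor with a
    multiplier that clears all the denominators. *)
Lemma tens_eq0 (m : M) (q : rat) : tens m q = 0 -> q != 0 ->
  exists2 k : nat, (0 < k)%N & m *+ k = 0.
Proof.
move=> /qpi_eq0P/scaled_num_bilin[N N0 /(_ (denq q))]; rewrite fextU /scaled_num /=.
rewrite mulrC intrM -mulrA (mulrC _ q) -numqE -intrM numq_int => h q0.
have z0 : N * numq q != 0 by rewrite mulf_neq0 // numq_eq0.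
exists (absz (N * numq q)); first by rewrite absz_gt0.
move: h; case: (N * _) => n; first by rewrite -pmulrn.
by rewrite NegzE mulrNz => /eqP; rewrite oppr_eq0 -pmulrn => /eqP.
Qed.

End TensorRat.

(** * The intersection of the adic filtration *)

Section AdicCore.
Variables (R : comPzRingType) (I : {pred R}) (M : lmodType R).

Definition adic_core : {pred M} := fun x => `[< forall n, x \in adic I M n >].

Lemma adic_coreP x : reflect (forall n, x \in adic I M n) (x \in adic_core).
Proof. exact: (asboolP _). Qed.

Lemma adic_core_zmod_closed : zmod_closed adic_core.
Proof.
split; first by apply/adic_coreP => n; rewrite rpred0.
by move=> x y /adic_coreP hx /adic_coreP hy; apply/adic_coreP => n; rewrite rpredB ?hx ?hy.
Qed.

HB.instance Definition _ :=
  GRing.isZmodClosed.Build M adic_core adic_core_zmod_closed.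

End AdicCore.

Arguments adic_core {R} I M.

Lemma qmul_core (R : comPzRingType) (I : {pred R}) (M : lmodType R) q
    (t : tensor M rat) :
  t \in adic_core I (tensor M rat) -> qmul q t \in adic_core I (tensor M rat).
Proof. by move=> /adic_coreP h; apply/adic_coreP => n; apply: qmul_adic. Qed.

Lemma qmul_nat (M : zmodType) n (t : tensor M rat) : qmul n%:R t = t *+ n.
Proof.
elim: n => [|n IH]; last by rewrite mulrS qmulDl IH qmul1 mulrS.
have := qmulDl 0 0 t; rewrite addr0 mulr0n => /eqP.
by rewrite -subr_eq0 opprD addrA subrr sub0r oppr_eq0 => /eqP.
Qed.

Lemma qmulVn (M : zmodType) n (t : tensor M rat) :
  (0 < n)%N -> qmul n%:R^-1 (t *+ n) = t.
Proof.
move=> n0; rewrite -qmul_nat qmulA mulVf ?qmul1 //.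
by rewrite pnatr_eq0 -lt0n.
Qed.

Lemma subX1_expand (R : comPzRingType) (x : R) n :
  exists r, x ^+ n - 1 = (x - 1) *+ n + (x - 1) * (x - 1) * r.
Proof.
elim: n => [|n [r hr]]; first by exists 0; rewrite expr0 subrr mulr0 addr0.
exists (n%:R + x * r).
have -> : x ^+ n.+1 - 1 = x * (x ^+ n - 1) + (x - 1).
  by rewrite exprS mulrBr mulr1 addrA subrK.
by rewrite hr -mulr_natr -(mulr_natr _ n.+1) -natr1; ring.
Qed.

(** With u = x - 1, expanding x^m = 1 makes m u a multiple of u^2; since m acts
    invertibly on a rational module, u *: t can be rewritten as u *: (u *: t')
    any number of times. *)
Lemma unipotent_torsion_core (R : comPzRingType) (I : {pred R}) (M : lmodType R)
    (x : R) m (t : tensor M rat) :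
  (0 < m)%N -> x - 1 \in I -> x ^+ m = 1 ->
  (x - 1) *: t \in adic_core I (tensor M rat).
Proof.
move=> m0 uI xm; have [r] := subX1_expand x m.
rewrite xm subrr => /esym/eqP; rewrite addr_eq0 => /eqP hr.
apply/adic_coreP => n; elim: n t => // n IH t.
rewrite -(qmulVn t m0) raddfMn /= -scalerMnr scalerMnl hr -mulrA -mulrN -scalerA.
by apply: adicS => //; rewrite -mulrN -scalerA.
Qed.

(** * Commutators of elements of G'_Q *)

Lemma commMgJ (G : groupType) (x y z : G) :
  [~ x * y, z]%g = ([~ x, z] ^ y * [~ y, z])%g.
Proof.
rewrite !commgEl (conjMg x y z) invgM [((_ * _) ^ y)%g]conjgE -!mulgA.
by rewrite !conjgE !mulVKg.
Qed.

Lemma gbasis_sub1_aug (A : zmodType) (a : A) : gbasis a - 1 \in aug_ideal A.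
Proof.
by rewrite unfold_in /aug_ideal raddfB /= -gbasis0 /aug !fextU subrr.
Qed.

Lemma gbasisX (A : zmodType) (a : A) n : gbasis a ^+ n = gbasis (a *+ n).
Proof.
by elim: n => [|n IH]; rewrite ?expr0 ?mulr0n ?gbasis0 // exprS IH mulrS gbasisD.
Qed.

Lemma gbasis_scale_alex (G : groupType) (g : G) (b : Alex G) : 
  gbasis (cls (gab_sec G) g : Gab G) *: b = conj_cls g b :> quosec (alex_sec G).
Proof. by rewrite -gab_actE; exact: gscaleU. Qed.

Section Metabelian.
Variable G : groupType.

Local Notation I := (aug_ideal (Gab G)).
Local Notation BtQ := (tensor (Alex G) rat).
Local Notation core := (adic_core I BtQ).

Lemma tors_act_core (a : Gab G) (t : BtQ) :
  a \in @tors (Gab G) -> gbasis a *: t - t \in core.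
Proof.
move=> /asboolP[m [m0 am]]; rewrite -{2}[t]scale1r -scalerBl.
by apply: (unipotent_torsion_core _ m0 (gbasis_sub1_aug a)); rewrite gbasisX am.
Qed.

(** The class of an element of G' in B(G) (x) Q, with a junk value outside G'. *)
Definition alexq (k : G) : BtQ := tens (cls (alex_sec G) k : Alex G) 1.

Lemma alexqM k l : k \in @der1 G -> l \in @der1 G ->
  alexq (k * l)%g = alexq k + alexq l.
Proof. by move=> hk hl; rewrite /alexq clsD // tens_addl. Qed.

Lemma alexqV k : k \in @der1 G -> alexq k^-1%g = - alexq k.
Proof. by move=> hk; rewrite /alexq clsN // -[LHS]/(tensl _ _) raddfN. Qed.

Lemma alexqJ k g : k \in @der1 G ->
  alexq (k ^ g)%g = gbasis (cls (gab_sec G) g^-1%g : Gab G) *: alexq k.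
Proof.
move=> hk; rewrite /alexq scale_tens; congr tens; apply: esym.
etransitivity; first exact: gbasis_scale_alex.
rewrite conj_clsE //; [|exact: der1_normal|exact: der2_normal].
by rewrite invgK conjgE mulgA.
Qed.

Lemma derQ1_tors g : g \in @derQ1 G -> (cls (gab_sec G) g : Gab G) \in @tors (Gab G).
Proof.
move=> /asboolP[m [m0 hm]]; apply/asboolP; exists m; split=> //.
by rewrite -clsMn //; apply/cls_eq0.
Qed.

Lemma alexqJ_core k g : k \in @der1 G -> g \in @derQ1 G ->
  alexq (k ^ g)%g - alexq k \in core.
Proof.
move=> hk hg; rewrite alexqJ //; apply/tors_act_core/derQ1_tors.
exact: (@topV _ (alexQ_sec G)).
Qed.

(** Modulo the core, h |-> [h, g] is a homomorphism: the conjugation in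
    [x y, g] = [x, g]^y [y, g] is by an element of G'_Q, which acts trivially. *)
Lemma alexq_commX_core h g n : h \in @derQ1 G ->
  alexq [~ (h ^+ n)%g, g]%g - alexq [~ h, g]%g *+ n \in core.
Proof.
have c1 x y : [~ x, y]%g \in @der1 G by apply: der1_comm.
move=> hh; elim: n => [|n IH].
  by rewrite expg0 comm1g mulr0n subr0 /alexq -[tens _ _]/(tensl _ _) cls0 raddf0 rpred0.
rewrite expgS commMgJ alexqM ?der1_normal // mulrS opprD addrACA rpredD //.
by apply: alexqJ_core => //; apply: (@topX _ (alexQ_sec G)).
Qed.

(** If h^m is in G', then [h^m, g] = (h^m)^-1 (h^m)^g is in the core because
    conjugation by g is trivial there; now divide by m. *)
Lemma alexq_comm_core h g : h \in @derQ1 G -> g \in @derQ1 G ->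
  alexq [~ h, g]%g \in core.
Proof.
move=> hh hg; have /asboolP[m [m0 hm]] := hh.
rewrite -(qmulVn (alexq _) m0); apply: qmul_core.
rewrite -(subKr (alexq [~ (h ^+ m)%g, g]%g) (_ *+ m)) rpredB ?alexq_commX_core //.
rewrite commgEl alexqM ?der1_normal ?(@topV _ (alex_sec G)) //.
by rewrite alexqV // addrC alexqJ_core.
Qed.

(** The elements of G' that die modulo the core; a subgroup through which the
    commutators of G'_Q can be tested on generators. *)
Definition der1_core : {pred G} := fun k => (k \in @der1 G) && (alexq k \in core).

Lemma der1_core_closed : group_closed der1_core.
Proof.
split.
  rewrite unfold_in (@top1 _ (alex_sec G)) /alexq -[tens _ _]/(tensl _ _) cls0.
  by rewrite raddf0 rpred0.
move=> x y /andP[hx cx] /andP[hy cy]; have hyV := @topV _ (alex_sec G) _ hy.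
apply/andP; split; first exact: (@topM _ (alex_sec G)).
rewrite (alexqM hx hyV) (alexqV hy).
exact: rpredB cx cy.
Qed.

Lemma commQ_core : {subset gcomm (@derQ1 G) (@derQ1 G) <= der1_core}.
Proof.
apply: gcomm_sub => [|x y hx hy]; first exact: der1_core_closed.
by apply/andP; split; [apply: der1_comm|apply: alexq_comm_core].
Qed.

(** If b / d is killed, a positive multiple of the class b is represented by a
    power of its representative that lies in [G'_Q, G'_Q]; then undo the
    multiplication. *)
Lemma kappaQ_ker (t : BtQ) : kappaQ t = 0 -> t \in core.
Proof.
have [b [d [d0 ->]]] := tens_pure t; rewrite [kappaQ _]tmapE /= => /tens_eq0.
rewrite invr_eq0 pnatr_eq0 -lt0n => /(_ d0)[k k0 hk].
set g := rep b; have hg : g \in @der1 G := @rep_top _ (alex_sec G) b.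
have eb : b = cls (alex_sec G) g :> Alex G by rewrite [RHS]repK.
move: hk; rewrite eb kappaE // -[_ *+ k](@clsMn _ (alexQ_sec G)) ?der_sub_Q //.
move/cls_eq0 => /(_ (@topX _ (alexQ_sec G) _ k (der_sub_Q hg)))/asboolP[m [m0]].
rewrite -expgnA => /commQ_core/andP[_].
have -> : alexq (g ^+ (k * m))%g =
    tens (cls (alex_sec G) g : Alex G) (1 *+ (k * m)).
  by rewrite -tens_mulrn /alexq (@clsMn _ (alex_sec G) g (k * m) hg).
move=> h.
have -> : tens (cls (alex_sec G) g : Alex G) d%:R^-1 =
    qmul (d%:R^-1 / (k * m)%:R) (tens (cls (alex_sec G) g : Alex G) (1 *+ (k * m))).
  by rewrite qmulE mulfVK // pnatr_eq0 -lt0n muln_gt0 k0.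
exact: qmul_core.
Qed.

End Metabelian.

(** * Maps that are strict for the adic filtrations *)

Section Strict.
Variables (R S : comPzRingType) (I : {pred R}) (J : {pred S}).
Variables (M : lmodType R) (N : lmodType S).

Definition adic_onto (psi : M -> N) := forall n y, y \in adic J N n ->
  exists2 x, x \in adic I M n & psi x = y.

Lemma semilinear_adic_onto (phi : R -> S) (psi : {additive M -> N}) :
  (forall b, b \in J -> exists2 a, a \in I & phi a = b) ->
  (forall a m, psi (a *: m) = phi a *: psi m) -> surj psi -> adic_onto psi.
Proof.
move=> phiJ psiZ psi_surj; elim=> [|n IH] y.
  by move=> _; have [x <-] := psi_surj y; exists x.
move/asboolP; elim=> [|_ [b [z [bJ zn ->]]]|y1 y2 _ [x1 h1 <-] _ [x2 h2 <-]].
- by exists 0; rewrite ?rpred0 ?raddf0.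
- have [a aI <-] := phiJ b bJ; have [x xn <-] := IH z zn.
  by exists (a *: x); rewrite ?psiZ //; apply: adicS.
by exists (x1 - x2); rewrite ?raddfB // rpredB.
Qed.

Variable psi : adicHom I J M N.
Hypothesis onto : adic_onto psi.

(** Lift the first component of a coherent sequence, and then each difference
    of consecutive components, at its own filtration level: the partial sums
    converge.  This is the Mittag-Leffler argument for the tower of kernels,
    whose transition maps are onto. *)
Lemma cmap_surj : surj (cmap psi).
Proof.
move=> y; set t := clift y.
have dt n : t n.+1 - t n \in adic J N n by apply/clifts_coherent/cliftP.
have /choice[e he] n : exists d, d \in adic I M n /\ psi d = t n.+1 - t n.
  by have [d dn ed] := onto (dt n); exists d.
have [x0 _ ex0] := onto (n := 0%N) (y := t 0%N) isT.
pose s n := x0 + \sum_(i < n) e i.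
have sS n : s n.+1 - s n \in adic I M n.
  by rewrite /s big_ord_recr /= addrA [_ + e n]addrC addrK; have [] := he n.
have psis n : psi (s n) = t n.
  elim: n => [|n IH]; first by rewrite /s big_ord0 addr0.
  by rewrite /s big_ord_recr /= addrA raddfD /= IH (he n).2 addrC subrK.
exists (cmk sS); apply: (clifts_inj (clifts_map psi (cmkP sS))) => n.
by rewrite /= psis; apply: cliftP.
Qed.

(** Components that vanish must be lifted to vanishing ones, so that the lift
    still has finite support. *)
Lemma gmap_surj : surj (gmap psi).
Proof.
move=> y; have ht := gliftP y; set t := glift y in ht.
have /choice[s hs] n : exists d, [/\ d \in adic I M n, psi d = t n &
    t n \in adic J N n.+1 -> d \in adic I M n.+1].
  have [tn|tn] := boolP (t n \in adic J N n.+1).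
    by have [d dn ed] := onto tn; exists d; split=> //; apply: adic_leS.
  by have [d dn ed] := onto (ht n).1; exists d.
have sok : gok I s.
  split=> [n|]; first by have [] := hs n.
  have [k hk] := glifts_fin ht; exists k => n /hk.
  by have [_ _ h] := hs n.
exists (gmk sok); apply: (glifts_inj (glifts_map psi (gmkP sok))).
by apply: (glifts_eq ht) => n; have [_ e _] := hs n; rewrite /= e.
Qed.

Hypothesis strict : forall n x, psi x \in adic J N n -> x \in adic I M n.

Lemma cmap_filt n x : (cmap psi x \in cfilt J N n) = (x \in cfilt I M n).
Proof.
rewrite !unfold_in /cfilt (clifts_map psi (cliftP x)) (cliftP x n) /=.
apply/eqP/eqP => /qpi_eq0P h; apply/qpi_eq0P; first exact: strict.
exact: ahomP.
Qed.

Lemma gmap_val0 x n : (val (gmap psi x) n = 0) <-> (val x n = 0).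
Proof.
rewrite (glifts_map psi (gliftP x) n).2 (gliftP x n).2 /=.
split=> /qpi_eq0P h; apply/qpi_eq0P; first exact: strict.
exact: ahomP.
Qed.

Lemma gmap_deg n x : (gmap psi x \in gdeg J N n) = (x \in gdeg I M n).
Proof. by apply/asboolP/asboolP => h k /h /gmap_val0. Qed.

Lemma cmap_inj : injective (cmap psi).
Proof.
move=> x y e; apply/eqP; rewrite -subr_eq0; apply/eqP/val_inj.
apply/functional_extensionality_dep => n; apply/eqP.
by rewrite -[_ == _]/(_ \in cfilt I M n) -cmap_filt raddfB /= e subrr unfold_in /cfilt.
Qed.

Lemma gmap_inj : injective (gmap psi).
Proof.
move=> x y e; apply/eqP; rewrite -subr_eq0; apply/eqP/val_inj.
have e0 : gmap psi (x - y) = 0 by rewrite [LHS]raddfB /= e subrr.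
apply/functional_extensionality_dep => n.
by apply/(gmap_val0 (x - y) n); rewrite e0.
Qed.

End Strict.

Lemma surj_inj_bij (X Y : Type) (f : X -> Y) : injective f -> surj f -> bijective f.
Proof.
move=> f_inj /choice[g fg]; exists g => // x; exact/f_inj/fg.
Qed.

(** * Semilinearity of the induced maps *)

Section RatMaps.
Variables (R S : comPzRingType) (I : {pred R}) (J : {pred S}).
Variables (phi : {rmorphism R -> S}) (phiI : forall a, a \in I -> phi a \in J).
Variables (M : lmodType R) (N : lmodType S).
Variable psi : adicHom I J (tensor M rat) (tensor N rat).
Hypothesis psiZ : forall a m, psi (a *: m) = phi a *: psi m.
Hypothesis psiq : forall q m, psi (qmul q m) = qmul q (psi m).

Lemma cmap_covers :
  covers (M := completionQ I M) (N := completionQ J N)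
    (tmap (cring_map phiI) idfun) (cmap psi).
Proof.
split; first exact: raddfB.
move=> t x; elim/tens_ind: t => [a q|s t hs ht]; last first.
  by rewrite scalerBl !raddfB /= hs ht scalerBl.
rewrite [tmap _ _ _]tmapE /=.
have eS := rat_actE (cact_biadd I M) (cqmul_biadd I M) a q x.
have eT := rat_actE (cact_biadd J N) (cqmul_biadd J N) (cring_map phiI a) q (cmap psi x).
etransitivity; first exact: congr1 eS.
apply: esym; etransitivity; first exact: eT.
have ha := cliftP a; have hx := cliftP x.
apply: (clifts_inj (clifts_act (clifts_map (ring_adicHom phiI) ha)
  (clifts_map (qmul_hom J N q) (clifts_map psi hx)))) => n.
rewrite (clifts_map psi (clifts_act ha (clifts_map (qmul_hom I M q) hx))).
by rewrite /= psiZ psiq.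
Qed.

Lemma gmap_covers :
  covers (M := grQ I M) (N := grQ J N)
    (tmap (grring_map phiI) idfun) (gmap psi).
Proof.
split; first exact: raddfB.
move=> t x; elim/tens_ind: t => [a q|s t hs ht]; last first.
  by rewrite scalerBl !raddfB /= hs ht scalerBl.
rewrite [tmap _ _ _]tmapE /=.
have eS := rat_actE (gact_biadd I M) (gqmul_biadd I M) a q x.
have eT := rat_actE (gact_biadd J N) (gqmul_biadd J N) (grring_map phiI a) q (gmap psi x).
etransitivity; first exact: congr1 eS.
apply: esym; etransitivity; first exact: eT.
have ha := gliftP a; have hx := gliftP x.
apply: (glifts_inj (glifts_act (glifts_map (ring_adicHom phiI) ha)
  (glifts_map (qmul_hom J N q) (glifts_map psi hx)))).
apply: (glifts_eq (glifts_map psi (glifts_act ha (glifts_map (qmul_hom I M q) hx)))) => n.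
rewrite /conv /= raddf_sum; apply: eq_bigr => i _.
by rewrite /= psiZ psiq.
Qed.

End RatMaps.

Lemma tmap_surj (M M' : zmodType) (f : {additive M -> M'}) :
  surj f -> surj (tmap f (idfun : rat -> rat)).
Proof.
move=> fs; elim/tens_ind=> [m q|_ _ [s <-] [t <-]]; last by exists (s - t); rewrite raddfB.
by have [x <-] := fs m; exists (tens x q); rewrite tmapE.
Qed.

Lemma tmap_tensQ_sub (M M' : zmodType) (f : {additive M -> M'}) (F : {pred M})
    (F' : {pred M'}) :
  (forall x, x \in F -> f x \in F') ->
  forall t, t \in tensQ_sub F -> tmap f (idfun : rat -> rat) t \in tensQ_sub F'.
Proof.
move=> fF; apply: (zspan_sub (f := tmap f (idfun : rat -> rat))
  (T := zspan (fun t => exists m q, m \in F' /\ t = tens m q))).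
move=> _ [m [q [mF ->]]]; apply: mem_zspan; exists (f m), q; split; first exact: fF.
exact: tmapE.
Qed.

(** * The maps induced by kappa *)

Lemma gring_map_surj (A B : zmodType) (f : {additive A -> B}) :
  surj f -> surj (gring_map f).
Proof.
move=> fs; elim/gring_ind=> [b|_ _ [x <-] [y <-]].
  by have [a <-] := fs b; exists (gbasis a); rewrite gring_mapU.
by exists (x - y); rewrite raddfB.
Qed.

Section KappaLifting.
Variable G : groupType.

Local Notation I := (aug_ideal (Gab G)).
Local Notation I0 := (aug_ideal (Gabf G)).

Lemma nu_surj : surj (@nu G).
Proof. by move=> x; exists (repr x); exact: (@qpiK _ (@tors (Gab G)) x). Qed.

Lemma nu_tilde_surj_aug b : b \in I0 -> exists2 a, a \in I & @nu_tilde G a = b.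
Proof.
move=> hb; have [a ea] := gring_map_surj nu_surj b; exists a => //.
by move: hb; rewrite -ea !unfold_in /aug_ideal aug_gring_map.
Qed.

Lemma nu_tilde_onto : adic_onto I I0 (rmap_o (@nu_tilde G)).
Proof.
apply: (semilinear_adic_onto (phi := @nu_tilde G) (psi := rmap_o (@nu_tilde G))).
- exact: nu_tilde_surj_aug.
- move=> a m; exact: (rmorphM (@nu_tilde G)).
exact: (gring_map_surj nu_surj).
Qed.

(** If g^m is in G', the class of g is that of g^m divided by m. *)
Lemma kappaQ_surj : surj (@kappaQ G).
Proof.
elim/tens_ind=> [b q|_ _ [s <-] [t <-]]; last by exists (s - t); rewrite raddfB.
set g := rep b; have hg : g \in @derQ1 G := @rep_top _ (alexQ_sec G) b.
have eb : b = cls (alexQ_sec G) g :> AlexQ G by rewrite [RHS]repK.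
have /asboolP[m [m0 hm]] := hg.
exists (tens (cls (alex_sec G) (g ^+ m)%g : Alex G) (q / m%:R)).
rewrite [LHS]tmapE /= (kappaE hm).
rewrite (@clsMn _ (alexQ_sec G) g m hg) tens_mulrn -eb.
by congr tens; rewrite -[LHS]mulr_natr mulfVK // pnatr_eq0 -lt0n.
Qed.

Lemma kappaQ_onto : adic_onto I I0 (@kappaQ G).
Proof.
apply: (semilinear_adic_onto (phi := @nu_tilde G) nu_tilde_surj_aug).
  exact: kappaQ_semilinear.
exact: kappaQ_surj.
Qed.

(** An element with image in level n differs from one of level n by an element
    of the kernel, and the kernel lies in all levels. *)
Lemma kappaQ_strict n t :
  kappaQ t \in adic I0 (tensor (AlexQ G) rat) n -> t \in adic I (tensor (Alex G) rat) n.
Proof.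
move=> /kappaQ_onto[s sn e]; rewrite -(subrK s t) rpredD //.
have : kappaQ (t - s) = 0 by rewrite raddfB /= e subrr.
by move/kappaQ_ker/adic_coreP/(_ n).
Qed.

Lemma kappaQ_qmul q (t : tensor (Alex G) rat) : kappaQ (qmul q t) = qmul q (kappaQ t).
Proof.
elim/tens_ind: t => [b p|s t hs ht]; last by rewrite !raddfB /= hs ht.
have kappaQE p' : kappaQ (tens b p') = tens (kappa b) p' by exact: tmapE.
have eL := etrans (congr1 (@kappaQ G) (qmulE q b p)) (kappaQE (q * p)).
have eR := etrans (congr1 (@qmul (AlexQ G) q) (kappaQE p)) (qmulE q (kappa b) p).
exact: etrans eL (esym eR).
Qed.

End KappaLifting.

Theorem theorem6p9 (G : groupType) (b1G : b1_finite G) :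
  ([/\ ring_hom (@nu_hatQ G),
       surj (@nu_hatQ G) &
       respects (@filt_R G) (@filt_R0 G) (@nu_hatQ G)] /\
   covers (@nu_hatQ G) (@kappa_hatQ G) /\
   iso_respects (@filt_B G) (@filt_BQ G) (@kappa_hatQ G)) /\
  ([/\ ring_hom (@nu_grQ G),
       surj (@nu_grQ G) &
       respects (@deg_R G) (@deg_R0 G) (@nu_grQ G)] /\
   covers (@nu_grQ G) (@kappa_grQ G) /\
   iso_respects (@deg_B G) (@deg_BQ G) (@kappa_grQ G)).
Proof.
set phiI := @nu_tilde_aug G.
have onto := @kappaQ_onto G; have strict := @kappaQ_strict G.
have nu_onto : adic_onto _ _ (ring_adicHom phiI) := @nu_tilde_onto G.
split; split.
- split.
  + by split; [exact: raddfB|exact: tmap_monoid].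
  + exact: tmap_surj (cmap_surj nu_onto).
  + move=> n; apply: tmap_tensQ_sub => x /eqP xn; apply/eqP.
    rewrite (clifts_map (ring_adicHom phiI) (cliftP x)).
    by apply/qpi_eq0P/ahomP/qpi_eq0P; rewrite -(cliftP x).
- split; first exact: (cmap_covers (psi := kappaQ_hom G) phiI (@kappaQ_semilinear G) (@kappaQ_qmul G)).
  split; last exact: (cmap_filt (psi := kappaQ_hom G) strict).
  apply: surj_inj_bij; first exact: (cmap_inj (psi := kappaQ_hom G) strict).
  exact: (cmap_surj (psi := kappaQ_hom G) onto).
- split.
  + by split; [exact: raddfB|exact: tmap_monoid].
  + exact: tmap_surj (gmap_surj nu_onto).
  + move=> n; apply: tmap_tensQ_sub => x /asboolP xn; apply/asboolP => k /xn.
    rewrite (gliftP x k).2 (glifts_map (ring_adicHom phiI) (gliftP x) k).2.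
    by move=> /qpi_eq0P h; apply/qpi_eq0P/ahomP.
- split; first exact: (gmap_covers (psi := kappaQ_hom G) phiI (@kappaQ_semilinear G) (@kappaQ_qmul G)).
  split; last exact: (gmap_deg (psi := kappaQ_hom G) strict).
  apply: surj_inj_bij; first exact: (gmap_inj (psi := kappaQ_hom G) strict).
  exact: (gmap_surj (psi := kappaQ_hom G) onto).
Qed.
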